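(* Let $X$ be an affine variety over $\mathbb{K}$ of dimension at least one, and let $X^{\mathrm{reg}}$ be its smooth locus. Then $X$ is flexible if and only if there exists a transversal covering of $X^{\mathrm{reg}}$ by cylinders which are principal in $X$.
   Context: $\mathbb{K}$ is an algebraically closed field of characteristic zero; a variety is an integral separated scheme of finite type over $\mathbb{K}$. $\mathbb{G}_\mathrm{a} = (\mathbb{K},+)$. A smooth point $x$ of a variety $X$ is flexible if the tangent space $T_xX$ is spanned by tangent vectors to orbits of effective (algebraic) $\mathbb{G}_\mathrm{a}$-actions on $X$; $X$ is flexible if every smooth point is flexible. For a positive integer $k$, a $k$-cylinder in a variety $X$ is an open subset $U \subseteq X$ together with an isomorphism $U \cong \mathbb{A}^k \times Z$ for some affine variety $Z$; a cylinder is a $k$-cylinder for some $k \ge 1$. A cylinder $U$ is principal in an affine variety $X$ if $U = \{x \in X \mid h(x) \neq 0\}$ for some regular function $h$ on $X$. Given a cylinder $U \cong \mathbb{A}^k \times Z$ in $X$ with projection $\pi \colon U \to Z$, a subset $S \subseteq X$ is invariant with respect to $U$ if $S \cap U = \pi^{-1}(\pi(S \cap U))$; it is invariant with respect to a collection of cylinders if it is invariant with respect to each of them. A collection $\{U_i\}_{i \in I}$ of cylinders is transversal if no nonempty proper subset of $\bigcup_{i\in I} U_i$ is invariant with respect to the collection. A transversal covering of a variety $V$ is a transversal collection of cylinders in $V$ whose union is $V$. *)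

(* Defs.v *)
(* Affine varieties over an algebraically closed field K are given in classical
   form, as irreducible closed sets of K-points of an affine space 'rV[K]_n;
   "point" means K-point. *)
From HB Require Import structures.
From mathcomp Require Import all_boot all_order all_algebra.
From mathcomp Require Import mpoly.
From mathcomp Require Import boolp classical_sets.
Set Implicit Arguments.
Unset Strict Implicit.
Unset Printing Implicit Defensive.
Import GRing.Theory.
Local Open Scope classical_set_scope.
Local Open Scope ring_scope.

Section Varieties.
Variables (K : closedFieldType) (n : nat).
Implicit Types (X U V S T : set 'rV[K]_n) (x v : 'rV[K]_n) (p q : {mpoly K[n]}).

Definition peval p x : K := p.@[x 0].

Definition zero_locus (I : set {mpoly K[n]}) : set 'rV[K]_n :=
  [set x : 'rV[K]_n | forall p, I p -> peval p x = 0].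

Definition zariski_closed S : Prop := exists I, S = zero_locus I.

Definition irreducible S : Prop :=
  S !=set0 /\
  forall A B, zariski_closed A -> zariski_closed B ->
    S `<=` A `|` B -> S `<=` A \/ S `<=` B.

Definition affine_variety X : Prop := zariski_closed X /\ irreducible X.

(* U is an open subset of V for the topology induced from affine space. *)
Definition open_in V U : Prop := exists2 C, zariski_closed C & U = V `\` C.

(* Regular functions on a locally closed set U: those which are locally
   quotients of polynomials.  The values of f outside U are irrelevant. *)
Definition regular_on U (f : 'rV[K]_n -> K) : Prop :=
  forall x, U x -> exists V p q,
    [/\ open_in U V, V x &
        forall y, V y -> peval q y != 0 /\ f y = peval p y / peval q y].

(* [krull_dim X d]: d is the supremum of the lengths of the strict chains
   F 0 < ... < F e of irreducible closed subsets of X. *)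
Definition irreducible_chain X (e : nat) (F : nat -> set 'rV[K]_n) : Prop :=
  (forall i, (i <= e)%N -> affine_variety (F i) /\ F i `<=` X) /\
  (forall i, (i < e)%N -> F i `<` F i.+1).

Definition krull_dim X (d : nat) : Prop :=
  (exists F, irreducible_chain X d F) /\
  (forall e F, irreducible_chain X e F -> (e <= d)%N).

(* Zariski tangent space at x of the locally closed set S, as a set of vectors
   of the ambient space. *)
Definition tangent_space S x : set 'rV[K]_n :=
  [set v : 'rV[K]_n | forall p, (forall y, S y -> peval p y = 0) ->
     \sum_(i < n) peval (p^`M(i)) x * v 0 i = 0].

Definition linear_span T : set 'rV[K]_n :=
  [set v : 'rV[K]_n | exists s : seq 'rV[K]_n,
     (forall w, w \in s -> T w) /\ v \in <<s>>%VS].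

Definition linear_dim T (d : nat) : Prop :=
  exists W : {vspace 'rV[K]_n}, T = [set v : 'rV[K]_n | v \in W] /\ \dim W = d.

Definition smooth_point X x : Prop :=
  X x /\ exists2 d, krull_dim X d & linear_dim (tangent_space X x) d.

Definition smooth_locus X : set 'rV[K]_n := [set x : 'rV[K]_n | smooth_point X x].

End Varieties.

Section Morphisms.
Variables (K : closedFieldType) (n m : nat).

Definition morphism (U : set 'rV[K]_n) (W : set 'rV[K]_m)
    (f : 'rV[K]_n -> 'rV[K]_m) : Prop :=
  (forall x, U x -> W (f x)) /\ (forall j, regular_on U (fun x => f x 0 j)).

(* A^n x W as a subset of A^(n + m). *)
Definition affine_times (W : set 'rV[K]_m) : set 'rV[K]_(n + m) :=
  [set y : 'rV[K]_(n + m) | W (rsubmx y)].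

End Morphisms.
Arguments affine_times {K} n {m} W.

Definition isomorphism (K : closedFieldType) (n m : nat)
    (U : set 'rV[K]_n) (W : set 'rV[K]_m) (f : 'rV[K]_n -> 'rV[K]_m) : Prop :=
  morphism U W f /\
  exists g, [/\ morphism W U g, forall x, U x -> g (f x) = x &
                forall y, W y -> f (g y) = y].

Section Flexibility.
Variables (K : closedFieldType) (n : nat).
Implicit Types (X : set 'rV[K]_n) (a : K -> 'rV[K]_n -> 'rV[K]_n).

Definition Ga_action X a : Prop :=
  [/\ morphism (affine_times 1 X) X
        (fun y : 'rV[K]_(1 + n) => a (lsubmx y 0 0) (rsubmx y)),
      forall x, X x -> a 0 x = x &
      forall s t x, X x -> a (s + t) x = a s (a t x)].

Definition effective X a : Prop :=
  forall t, (forall x, X x -> a t x = x) -> t = 0.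

Definition orbit a (x : 'rV[K]_n) : set 'rV[K]_n := [set a t x | t in setT].

Definition flexible_point X x : Prop :=
  tangent_space X x =
  linear_span [set v : 'rV[K]_n | exists a, [/\ Ga_action X a, effective X a &
                                     tangent_space (orbit a x) x v]].

Definition flexible X : Prop :=
  forall x, smooth_point X x -> flexible_point X x.

End Flexibility.

Section Cylinders.
Variables (K : closedFieldType) (n : nat).
Implicit Types (V S : set 'rV[K]_n).

Record cylinder V := Cylinder {
  cyl_set :> set 'rV[K]_n;
  cyl_open : open_in V cyl_set;
  cyl_rank : nat;
  cyl_rank_gt0 : (0 < cyl_rank)%N;
  cyl_embdim : nat;
  cyl_base : set 'rV[K]_cyl_embdim;
  cyl_base_variety : affine_variety cyl_base;
  cyl_iso : 'rV[K]_n -> 'rV[K]_(cyl_rank + cyl_embdim);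
  cyl_isoP : isomorphism cyl_set (affine_times cyl_rank cyl_base) cyl_iso
}.

Definition cyl_proj V (U : cylinder V) (x : 'rV[K]_n) :
  'rV[K]_(cyl_embdim U) := rsubmx (cyl_iso U x).

(* The projection is only meaningful on U, hence the intersection with U. *)
Definition invariant V (U : cylinder V) S : Prop :=
  S `&` U = U `&` (cyl_proj U @^-1` (cyl_proj U @` (S `&` U))).

Definition principal X V (U : cylinder V) : Prop :=
  exists2 h, regular_on X h & (U : set 'rV[K]_n) = [set x : 'rV[K]_n | X x /\ h x != 0].

Definition transversal V (I : Type) (C : I -> cylinder V) : Prop :=
  forall S, S !=set0 -> S `<` \bigcup_i (C i : set 'rV[K]_n) ->
    ~ (forall i, invariant (C i) S).

Definition transversal_covering V (I : Type) (C : I -> cylinder V) : Prop :=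
  transversal C /\ \bigcup_i (C i : set 'rV[K]_n) = V.

End Cylinders.

(* Main.v *)
(* (=>) The tangent line to an orbit of an action of the additive group is spanned
   by the velocity of the action, so near a point y the flows of actions whose
   velocities span T_y X parametrize a dense subset of X: a function killed by the
   parametrization, together with d coordinates independent on its image, would be
   d + 1 independent functions on X, whereas no point of X has a tangent space of
   dimension less than the number of independent functions.  Each action has a
   slice f, moving as f + t h with h invariant; this makes D(h) a principal cylinder
   whose fibres are orbits, and h can be chosen to vanish on the singular locus.
   Moving a smooth point y by automorphisms into the common domain of such slices
   gives cylinders around y whose directions span T_y X.  A subset invariant under
   all principal cylinders then contains a dense open set near each of its points;
   the same holds for its complement, so one of the two is empty.

   (<=) If D(h) = A^k x Z, then h is constant on the fibres, and translations of A^k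
   with time rescaled by a large power of h extend to actions on X.  Among the
   families of points obtained from x0 by composing such actions choose one with
   maximal closure (chains in X have bounded length): its closure is stable under all
   the actions, hence invariant, hence X by transversality.  In characteristic zero a
   dominant family has a differential of rank at least d at some point g x0, and
   pulling back by g the velocities which make up this differential shows that x0 is
   flexible.

   Both parts rest on one fact: a derivation (or a general enough K-point) of a ring
   A with a homomorphism to a field L extends along A -> A[th], th in L.  This gives
   the Nullstellensatz, Chevalley's theorem and the comparison of independent
   functions with tangent vectors. *)
Require Import Defs.
From HB Require Import structures.
From mathcomp Require Import all_boot all_order all_algebra.
From mathcomp Require Import mpoly.
From mathcomp Require Import boolp classical_sets.
From mathcomp Require Import ring.
Set Implicit Arguments.
Unset Strict Implicit.
Unset Printing Implicit Defensive.
Import GRing.Theory.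
Local Open Scope classical_set_scope.
Local Open Scope ring_scope.

(** * Extending points and derivations along ring extensions *)

Section PolyEval.
Variables (A B : comNzRingType) (f : {rmorphism A -> B}) (u : B).

Definition pev : {poly A} -> B := horner_eval u \o map_poly f.
HB.instance Definition _ := GRing.RMorphism.copy pev (horner_eval u \o map_poly f).

Lemma pevE p : pev p = (map_poly f p).[u]. Proof. by []. Qed.
Lemma pevC a : pev a%:P = f a. Proof. by rewrite pevE map_polyC hornerC. Qed.
Lemma pevX : pev 'X = u. Proof. by rewrite pevE map_polyX hornerX. Qed.

End PolyEval.

Section Extension.
Import Pdiv.Ring.
Variables (A : comNzRingType) (L : fieldType) (psi : {rmorphism A -> L}) (th : L).

Lemma lead_map_neq0 (p : {poly A}) :
  map_poly psi p != 0 -> exists k, psi p`_k != 0.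
Proof.
move=> p0; exists (size (map_poly psi p)).-1.
by rewrite -coef_map -lead_coefE lead_coef_eq0.
Qed.

(** Among relations of [th] with nonzero image under [psi], one of least size keeps its leading
    coefficient: otherwise dropping the leading term gives a shorter one with the same image. *)
Lemma minimal_relation :
  (forall p, pev psi th p = 0 -> map_poly psi p = 0) \/
  exists p, [/\ pev psi th p = 0, psi (lead_coef p) != 0, (1 < size p)%N &
    forall r : {poly A}, (size r < size p)%N -> pev psi th r = 0 -> map_poly psi r = 0].
Proof.
case: (pselect (forall p, pev psi th p = 0 -> map_poly psi p = 0)); first by left.
move=> /existsNP[p0 /not_implyP[p00 p0N]]; right.
pose Q m := `[< exists p : {poly A}, [/\ size p = m, pev psi th p = 0 & map_poly psi p != 0] >].
have exQ : exists m, Q m.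
  by exists (size p0); apply/asboolP; exists p0; split=> //; apply/eqP.
case: (ex_minnP exQ) => m /asboolP[p [sp pp0 pN]] minm.
have minP (r : {poly A}) : (size r < m)%N -> pev psi th r = 0 -> map_poly psi r = 0.
  move=> rm r0; apply: contrapT => /eqP rN.
  by move: rm; rewrite ltnNge minm //; apply/asboolP; exists r.
have pneq0 : p != 0 by apply: contraNneq pN => ->; rewrite rmorph0.
have lp : psi (lead_coef p) != 0.
  apply: contraNneq pN => lp0.
  pose r := p - (lead_coef p)%:P * 'X^((size p).-1).
  have rE : map_poly psi r = map_poly psi p.
    by rewrite /r rmorphB rmorphM /= map_polyC /= lp0 mul0r subr0.
  rewrite -rE minP //; last by rewrite pevE rE -pevE.
  rewrite -sp; have s0 : (0 < size p)%N by rewrite size_poly_gt0.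
  rewrite -(prednK s0) ltnS; apply/leq_sizeP => j.
  rewrite coefB coefCM coefXn leq_eqVlt => /orP[/eqP <-|lj].
    by rewrite eqxx mulr1 lead_coefE subrr.
  rewrite gtn_eqF // mulr0 subr0 nth_default //.
  by rewrite -(prednK s0).
exists p; split=> //; last by move=> r; rewrite sp; exact: minP.
rewrite ltnNge; apply/negP => /size1_polyC pC.
by move: pp0 lp; rewrite pC pevC lead_coefC => ->; rewrite eqxx.
Qed.

(** For transcendental [th], any nonroot [c] of the image of [q] serves. If [th] is a root of a
    minimal [p], then [c] must be a root of the image of [p] but not of [q], and pseudo-division by
    [p] turns this into the nonvanishing of a remainder. *)
Lemma extend_point_step (K : closedFieldType) (q : {poly A}) : pev psi th q != 0 ->
  exists2 q', psi q' != 0 & forall chi : {rmorphism A -> K},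
    (forall a, psi a = 0 -> chi a = 0) -> chi q' != 0 ->
    exists c, (forall p, pev psi th p = 0 -> pev chi c p = 0) /\ pev chi c q != 0.
Proof.
move=> q0; have [free|[p [pp0 lp sp minp]]] := minimal_relation.
  have [|k qk] := @lead_map_neq0 q.
    by apply: contraNneq q0 => q0; rewrite pevE q0 horner0.
  exists q`_k => // chi kerchi chik.
  have : map_poly chi q != 0.
    by apply: contraNneq chik => /(congr1 (coefp k)) /=; rewrite coef_map coef0 => ->.
  case/closed_nonrootP => c cq; exists c; split=> // r /free r0.
  rewrite pevE (_ : map_poly chi r = 0) ?horner0 //.
  apply/polyP => i; rewrite coef_map coef0 /=; apply: kerchi.
  by move/polyP: r0 => /(_ i); rewrite coef_map coef0.
have pneq0 : p != 0 by apply: contraTneq sp => ->; rewrite size_poly0.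
pose N f := rscalp f p.
have divE f : (lead_coef p ^+ N f)%:P * f = rdivp f p * p + rmodp f p.
  by rewrite mul_polyC Pdiv.ComRing.rdivp_eq.
have modE f : pev psi th (rmodp f p) = psi (lead_coef p) ^+ N f * pev psi th f.
  have /(congr1 (pev psi th)) := divE f.
  rewrite rmorphM /= pevC rmorphXn => ->.
  by rewrite rmorphD rmorphM /= pp0 mulr0 add0r.
(* If every root of the image of [p] were a root of the image of [q], the former would divide the
   [m]-th power of the latter, whatever the multiplicities. *)
pose m := (size p).
have [|k rk] := @lead_map_neq0 (rmodp (q ^+ m) p).
  apply/negP => /eqP r0; have := modE (q ^+ m); rewrite pevE r0 horner0.
  move/esym/eqP; rewrite mulf_eq0 expf_eq0 (negPf lp) andbF /=.
  by rewrite rmorphXn expf_eq0 (negPf q0) andbF.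
(* The first factor preserves the degree of [p] under [chi]; the second keeps the remainder of
   [q ^+ m] nonzero, which excludes that divisibility. *)
exists (lead_coef p * (rmodp (q ^+ m) p)`_k); first by rewrite rmorphM mulf_neq0.
move=> chi kerchi; rewrite rmorphM mulf_eq0 negb_or => /andP[clp crk].
have kerp (r : {poly A}) : map_poly psi r = 0 -> map_poly chi r = 0.
  move/polyP => r0; apply/polyP => i; move: (r0 i); rewrite !coef_map !coef0.
  exact: kerchi.
have szchi : size (map_poly chi p) = size p by rewrite size_map_poly_id0.
have [c cp cq] : exists2 c, root (map_poly chi p) c & ~~ root (map_poly chi q) c.
  apply: contrapT => nroot.
  have [rs rsE] := closed_field_poly_normal (map_poly chi p).
  have lcn0 : lead_coef (map_poly chi p) != 0.
    by rewrite lead_coef_eq0 -size_poly_eq0 szchi size_poly_eq0.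
  have srs : (size p = (size rs).+1)%N.
    by rewrite -szchi rsE size_scale // size_prod_XsubC.
  have dvd : map_poly chi p %| map_poly chi q ^+ m.
    rewrite rsE dvdpZl //; apply: (@dvdp_trans _ (map_poly chi q ^+ size rs)).
      have : {in rs, forall c, root (map_poly chi q) c}.
        move=> c crs; apply/negPn/negP => cN; apply: nroot; exists c => //.
        by rewrite rsE rootZ // root_prod_XsubC.
      elim: rs {rsE srs} => [|a rs IH] H; first by rewrite big_nil dvd1p.
      rewrite big_cons exprS dvdp_mul //.
        by rewrite dvdp_XsubCl H // mem_head.
      by apply: IH => c crs; apply: H; rewrite in_cons crs orbT.
    by rewrite dvdp_exp2l // /m srs.
  have := congr1 (map_poly chi) (divE (q ^+ m)).
  rewrite rmorphD !rmorphM /= map_polyC /= rmorphXn /= => E.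
  have : map_poly chi p %| map_poly chi (rmodp (q ^+ m) p).
    rewrite -(dvdp_addr _ (dvdp_mull (map_poly chi (rdivp (q ^+ m) p)) (dvdpp _))).
    by rewrite -E dvdp_mull // rmorphXn.
  have rn0 : map_poly chi (rmodp (q ^+ m) p) != 0.
    apply: contraNneq crk => /(congr1 (coefp k)) /=.
    by rewrite coef_map coef0 => ->.
  move/(dvdp_leq rn0); rewrite szchi leqNgt.
  by rewrite (leq_ltn_trans (size_poly _ _)) // ltn_rmodp.
exists c; split=> // f f0.
have : map_poly chi (rmodp f p) = 0.
  apply/kerp/minp; first by rewrite ltn_rmodp.
  by rewrite modE f0 mulr0.
move=> r0; have := congr1 (pev chi c) (divE f).
rewrite rmorphD !rmorphM /= pevC (rmorphXn chi) /= [X in _ * X + _]pevE [X in _ + X]pevE.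
rewrite r0 horner0 addr0 (eqP cp) mulr0 => /eqP.
by rewrite mulf_eq0 expf_eq0 (negPf clp) andbF => /eqP.
Qed.

End Extension.

Definition leibniz (A L : comNzRingType) (f D : A -> L) :=
  forall a b, D (a * b) = f a * D b + f b * D a.

Lemma leibniz1 (A L : comNzRingType) (f : {rmorphism A -> L}) (D : A -> L) :
  leibniz f D -> D 1 = 0.
Proof.
move=> lD; have := lD 1 1; rewrite mulr1 rmorph1 mul1r.
by move/eqP; rewrite -subr_eq subrr => /eqP <-.
Qed.

Lemma leibniz_horner (A B L : comNzRingType) (g : {rmorphism A -> B})
  (f : {rmorphism B -> L}) (D : {additive B -> L}) p T : leibniz f D ->
  (forall a, D (g a) = 0) ->
  D (map_poly g p).[T] = (map_poly (f \o g) p)^`().[f T] * D T.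
Proof.
move=> lD Dg; elim/poly_ind: p => [|p c IH].
  by rewrite !rmorph0 deriv0 !horner0 raddf0 mul0r.
rewrite !rmorphD !rmorphM /= !map_polyX !map_polyC /= hornerD hornerM hornerX hornerC.
rewrite raddfD /= Dg addr0 lD IH derivD derivM derivX derivC mulr1 addr0.
rewrite !hornerD hornerM hornerX -horner_map -map_poly_comp /=.
by ring.
Qed.

Section DerivationExtension.
Variables (A : comNzRingType) (L : fieldType) (psi : {rmorphism A -> L}).
Variables (D : {additive A -> L}) (lD : leibniz psi D) (th u : L).

(** The derivation of [A[X]] along [pev psi th] that extends [D] and sends the variable to [u]. *)
Definition dext (p : {poly A}) := (map_poly D p).[th] + pev psi th p^`() * u.

Lemma dext_is_additive : additive dext.
Proof.
move=> p q; rewrite /dext derivB !raddfB /= hornerD hornerN mulrBl.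
by rewrite opprD addrACA.
Qed.
HB.instance Definition _ := GRing.isAdditive.Build {poly A} L dext dext_is_additive.

Lemma dextC a : dext a%:P = D a.
Proof. by rewrite /dext derivC raddf0 mul0r addr0 map_polyC hornerC. Qed.

Lemma dextX : dext 'X = u.
Proof.
rewrite /dext derivX rmorph1 mul1r (_ : map_poly D 'X = 0) ?horner0 ?add0r //.
apply/polyP => i; rewrite coef_map coefX coef0 /=.
by case: (i == 1)%N => /=; rewrite ?raddf0 // (leibniz1 lD).
Qed.

Lemma dext_leibniz : leibniz (pev psi th) dext.
Proof.
have CM c q : dext (c%:P * q) = psi c * dext q + pev psi th q * D c.
  rewrite /dext derivM derivC mul0r add0r rmorphM /= pevC.
  have -> : map_poly D (c%:P * q) =
            (psi c)%:P * map_poly D q + (D c)%:P * map_poly psi q.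
    by apply/polyP => i; rewrite coef_map coefCM coefD !coefCM !coef_map /= lD [X in _ + X]mulrC.
  by rewrite hornerD !hornerM !hornerC !pevE; ring.
have XM q : dext ('X * q) = th * dext q + pev psi th q * u.
  rewrite /dext derivM derivX mul1r rmorphD rmorphM /= pevX.
  have -> : map_poly D ('X * q) = 'X * map_poly D q.
    apply/polyP => i; rewrite coef_map !coefXM.
    by case: ifP => _ /=; rewrite ?raddf0 ?coef_map.
  by rewrite hornerM hornerX; ring.
move=> p; elim/poly_ind: p => [|p c IH] q.
  by rewrite mul0r !raddf0 mul0r mulr0 addr0.
rewrite mulrDl -mulrA [LHS]raddfD /= IH CM XM.
have -> : dext (p * 'X + c%:P) = pev psi th p * u + th * dext p + D c.
  by rewrite raddfD /= IH dextX pevX dextC.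
by rewrite rmorphD !rmorphM /= pevX pevC; ring.
Qed.

End DerivationExtension.

(** When [th] is a root of a minimal [p], differentiating this relation forces [u], and
    pseudo-division by [p] carries the vanishing over to all other relations. A transcendental [th]
    leaves [u] free. *)
Lemma extend_derivation_step (A : comNzRingType) (L : fieldType)
  (psi : {rmorphism A -> L}) (D : {additive A -> L}) (th : L) :
  [pchar L] =i pred0 -> leibniz psi D -> (forall a, psi a = 0 -> D a = 0) ->
  exists u, forall p, pev psi th p = 0 -> dext psi D th u p = 0.
Proof.
move=> /pcharf0P charL lD kerD.
have kerp p u : map_poly psi p = 0 -> dext psi D th u p = 0.
  move=> p0; rewrite /dext pevE -deriv_map p0 deriv0 horner0 mul0r addr0.
  rewrite (_ : map_poly D p = 0) ?horner0 //.
  apply/polyP => i; rewrite coef_map coef0 /=; apply: kerD.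
  by move/polyP: p0 => /(_ i); rewrite coef_map coef0.
have [free|[p [pp0 lp sp minp]]] := minimal_relation psi th.
  by exists 0 => p /free /kerp.
have pneq0 : p != 0 by apply: contraTneq sp => ->; rewrite size_poly0.
(* The derivative is shorter than [p], so as a relation it would have zero image; but its top
   coefficient is a nonzero integer multiple of the leading one. *)
have dp : pev psi th p^`() != 0.
  apply/negP => /eqP /minp; rewrite lt_size_deriv // => /(_ isT) /polyP /(_ (size p).-2).
  rewrite coef_map coef0 coef_deriv /= raddfMn.
  have -> : (size p).-2.+1 = (size p).-1 by case: (size p) sp => [|[]].
  move/eqP; rewrite -mulr_natr mulf_eq0 -lead_coefE (negPf lp) charL /=.
  by case: (size p) sp => [|[]].
exists (- (map_poly D p).[th] / pev psi th p^`()) => f f0.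
set u := _ / _.
have Dp : dext psi D th u p = 0.
  by rewrite /dext mulrC mulfVK // addrN.
have lext := dext_leibniz lD th u.
have E := Pdiv.ComRing.rdivp_eq p f.
set N := Pdiv.Ring.rscalp f p in E.
have modE : pev psi th (Pdiv.Ring.rmodp f p) = 0.
  have /(congr1 (pev psi th)) := E.
  by rewrite -mul_polyC rmorphD !rmorphM /= f0 pp0 !mulr0 add0r.
have D0 : dext psi D th u (Pdiv.Ring.rmodp f p) = 0.
  by apply/kerp/minp => //; rewrite Pdiv.Ring.ltn_rmodp.
have := congr1 (dext psi D th u) E.
rewrite -mul_polyC raddfD /= !lext f0 mul0r addr0 pp0 mul0r Dp mulr0 !add0r D0.
move/eqP; rewrite mulf_eq0 pevC rmorphXn expf_eq0 (negPf lp) andbF /=.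
by move/eqP.
Qed.

(* [iota] and [b] present [B] as a polynomial ring over [A]; adjoining one
   variable at a time makes both extension properties iterate. *)
Lemma extension_tower (K : closedFieldType) (A : comNzRingType) (L : fieldType)
  (psi : {rmorphism A -> L}) s (th : 'I_s -> L) :
  exists (B : comNzRingType) (iota : {rmorphism A -> B})
         (Psi : {rmorphism B -> L}) (b : 'I_s -> B),
  [/\ forall a, Psi (iota a) = psi a, forall i, Psi (b i) = th i,
      forall q, Psi q != 0 -> exists2 q', psi q' != 0 &
        forall chi : {rmorphism A -> K},
        (forall a, psi a = 0 -> chi a = 0) -> chi q' != 0 ->
        exists chi' : {rmorphism B -> K}, [/\ forall a, chi' (iota a) = chi a,
          forall p, Psi p = 0 -> chi' p = 0 & chi' q != 0] &
      [pchar L] =i pred0 -> forall D : {additive A -> L}, leibniz psi D ->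
        (forall a, psi a = 0 -> D a = 0) ->
        exists D' : {additive B -> L}, [/\ leibniz Psi D',
          forall a, D' (iota a) = D a & forall p, Psi p = 0 -> D' p = 0]].
Proof.
elim: s th => [|s IH] th.
  exists A, idfun, psi, (fun i => 0); split=> //; first by case.
    by move=> q q0; exists q => // chi ker cq; exists chi.
  by move=> _ D lD kD; exists D.
have [B [iota [Psi [b [PsiE bE ptE derE]]]]] := IH (fun i => th (lift ord0 i)).
exists {poly B}, (polyC \o iota), (pev Psi (th ord0)),
  (fun i => if unlift ord0 i is Some j then (b j)%:P else 'X); split.
- by move=> a /=; rewrite pevC.
- move=> i; case: unliftP => [j|] -> /=; first by rewrite pevC.
  by rewrite pevX.
- move=> q /(extend_point_step K) [q1 /ptE [q' q'0 H'] H1]; exists q' => // chi ker cq'.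
  have [chi1 [c1E ker1 cq1]] := H' chi ker cq'.
  have [c [kc qc]] := H1 chi1 ker1 cq1.
  by exists (pev chi1 c); split=> // a /=; rewrite pevC.
move=> charL D lD kerD; have [D1 [lD1 D1E kerD1]] := derE charL D lD kerD.
have [u uP] := extend_derivation_step (th ord0) charL lD1 kerD1.
exists (dext Psi D1 (th ord0) u); split=> //; first exact: dext_leibniz.
by move=> a /=; rewrite dextC.
Qed.

(** * Homomorphisms out of polynomial rings and the chain rule *)

Section MpolyMaps.
Variable n : nat.

Lemma mpoly_ring_ind (R : comNzRingType) (P : {mpoly R[n]} -> Prop) :
  (forall c, P c%:MP) -> (forall i, P 'X_i) ->
  (forall p q, P p -> P q -> P (p + q)) -> (forall p q, P p -> P q -> P (p * q)) ->
  forall p, P p.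
Proof.
move=> PC PX PD PM p.
have PXk i k : P ('X_i ^+ k).
  by elim: k => [|k IH]; [rewrite expr0 -mpolyC1|rewrite exprS; apply: PM].
rewrite [p]mpolyE.
apply: big_ind => //; first by rewrite -mpolyC0.
move=> m _; rewrite -mul_mpolyC; apply/PM => //.
rewrite mpolyXE_id; apply: (big_ind P) => //; have := PC 1; by rewrite mpolyC1.
Qed.

Lemma rmorph_mmap (R B C : comNzRingType) (f : R -> B) (b : 'I_n -> B)
  (g : {rmorphism B -> C}) p : g (mmap f b p) = mmap (g \o f) (g \o b) p.
Proof.
rewrite /mmap rmorph_sum; apply: eq_bigr => m _; rewrite rmorphM /mmap1 rmorph_prod.
by congr (_ * _); apply: eq_bigr => i _; rewrite rmorphXn.
Qed.

Lemma eq_mmap (R B : comNzRingType) (f g : R -> B) (b c : 'I_n -> B) p :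
  f =1 g -> b =1 c -> mmap f b p = mmap g c p.
Proof. by move=> fg bc; rewrite (funext fg) (funext bc). Qed.

Lemma rmorph_mpolyE (R C : comNzRingType) (g : {rmorphism {mpoly R[n]} -> C}) p :
  g p = mmap (g \o @mpolyC n R) (fun i => g 'X_i) p.
Proof.
rewrite -[in LHS](comp_mpoly_id p) /comp_mpoly rmorph_mmap; apply: eq_mmap => // i.
by rewrite /= tnth_mktuple.
Qed.

Lemma mderivXU (R : comNzRingType) (i j : 'I_n) :
  ('X_i : {mpoly R[n]})^`M(j) = (i == j)%:R.
Proof.
rewrite mderivX mnm1E; case: eqP => [->|_]; last by rewrite scale0r.
by rewrite (_ : (U_(j) - U_(j) = 0)%MM) ?mpolyX0 ?scale1r //; apply/mnmP => k; rewrite mnmBE subnn mnm0E.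
Qed.

Lemma chain_rule (R B L : comNzRingType) (f : {rmorphism R -> B}) (b : 'I_n -> B)
  (psi : {rmorphism B -> L}) (D : {additive B -> L}) :
  leibniz psi D -> (forall c, D (f c) = 0) ->
  forall p, D (mmap f b p) = \sum_j psi (mmap f b p^`M(j)) * D (b j).
Proof.
move=> lD Df; elim/mpoly_ring_ind => [c|i|p q Hp Hq|p q Hp Hq].
- rewrite mmapC Df big1 // => j _; by rewrite mderivC !raddf0 mul0r.
- rewrite mmapX mmap1U (bigD1 i) //= mderivXU eqxx !rmorph1 mul1r.
  rewrite big1 ?addr0 // => j /negPf ji.
  by rewrite mderivXU eq_sym ji !raddf0 mul0r.
- rewrite !raddfD /= Hp Hq -big_split; apply: eq_bigr => j _ /=.
  by rewrite !raddfD /= mulrDl.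
rewrite rmorphM /= lD Hp Hq !mulr_sumr -big_split; apply: eq_bigr => j _ /=.
by rewrite mderivM rmorphD !rmorphM rmorphD !rmorphM /=; ring.
Qed.

End MpolyMaps.

Lemma rmorph_pchar0 (K L : fieldType) (f : {rmorphism K -> L}) :
  [pchar K] =i pred0 -> [pchar L] =i pred0.
Proof. by move=> cK p; rewrite (fmorph_pchar f) cK. Qed.

(** * Algebraic independence and dual derivations *)

Section AlgebraicIndependence.
Variables (K : closedFieldType) (L : fieldType) (f : {rmorphism K -> L}).

Definition alg_indep e (w : 'I_e -> L) :=
  forall F : {mpoly K[e]}, mmap f w F = 0 -> F = 0.

(* The derivations of K(w) dual to [w] extend to K(w, g), and their values on
   [g] are the vectors [v i]. *)
Lemma dual_derivations (charK : [pchar K] =i pred0) n (g : 'I_n -> L) e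
  (u : 'I_e -> {mpoly K[n]}) : alg_indep (fun k => mmap f g (u k)) ->
  exists v : 'I_e -> 'I_n -> L,
  (forall r i, mmap f g r = 0 -> \sum_j mmap f g r^`M(j) * v i j = 0) /\
  (forall k i, \sum_j mmap f g (u k)^`M(j) * v i j = (k == i)%:R).
Proof.
set w := fun k => _ => indep.
have [B [iota [Psi [b [PsiE bE _ derE]]]]] :=
  extension_tower K (mmap f w : {rmorphism {mpoly K[e]} -> L}) g.
pose al : {rmorphism K -> B} := iota \o (@mpolyC e K).
pose ev := mmap al b.
have PsiEv r : Psi (ev r) = mmap f g r.
  rewrite rmorph_mmap; apply: eq_mmap => [c|j] //=.
  by rewrite PsiE /= mmapC.
pose D0 i : {additive {mpoly K[e]} -> L} := (mmap f w) \o (mderiv i).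
have derD0 i : exists Di : {additive B -> L}, [/\ leibniz Psi Di,
    forall a, Di (iota a) = D0 i a & forall p, Psi p = 0 -> Di p = 0].
  apply: derE; first exact: rmorph_pchar0 f charK.
  - by move=> p q; rewrite /= mderivM rmorphD !rmorphM /=; ring.
  - by move=> a /indep ->; rewrite raddf0.
have [D' D'P] := choice derD0.
have chain i r : D' i (ev r) = \sum_j mmap f g r^`M(j) * D' i (b j).
  have [lD DE _] := D'P i.
  rewrite /ev (@chain_rule _ _ _ _ al b Psi).
  - by apply: eq_bigr => j _; rewrite -PsiEv.
  - by [].
  by move=> c; rewrite /= DE /= mderivC raddf0.
exists (fun i j => D' i (b j)); split=> [r i r0|k i]; rewrite -chain.
  by have [_ _] := D'P i; apply; rewrite PsiEv.
have [_ DE ker] := D'P i.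
(* Both elements map to [w k], and the extended derivations kill the kernel of [Psi]. *)
have /ker : Psi (ev (u k) - iota 'X_k) = 0.
  by rewrite rmorphB PsiEv PsiE /= mmapX mmap1U subrr.
by move/eqP; rewrite raddfB subr_eq0 DE /= mderivXU rmorph_nat => /eqP.
Qed.

End AlgebraicIndependence.

(** * The Nullstellensatz *)

Definition is_ideal (A : comNzRingType) (I : set A) : Prop :=
  [/\ I 0, forall a b, I a -> I b -> I (a + b) & forall r a, I a -> I (r * a)].

Definition is_prime (A : comNzRingType) (I : set A) : Prop :=
  [/\ is_ideal I, ~ I 1 & forall a b, I (a * b) -> I a \/ I b].

(** An inverse in the form that a unit ring structure on a quotient asks for: the identity away from
    the units. *)
Lemma comring_inverse (R : comNzRingType) :
  exists inv : R -> R, (forall x y, y * x = 1 -> inv x * x = 1) /\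
    (forall x, inv x * x <> 1 -> inv x = x).
Proof.
have : forall x : R, exists i, (forall y, y * x = 1 -> i * x = 1) /\ (i * x <> 1 -> i = x).
  move=> x; case: (pselect (exists y, y * x = 1)) => [[y yx]|no]; first by exists y.
  by exists x; split=> // y yx; case: no; exists y.
move=> /choice[inv invP]; exists inv.
by split=> x => [y|]; have [H1 H2] := invP x; [exact: H1|].
Qed.

(** The field is the fraction field of the quotient by [P]. *)
Lemma prime_kernel (A : comNzRingType) (P : set A) : is_prime P ->
  exists (L : fieldType) (psi : {rmorphism A -> L}), forall a, psi a = 0 <-> P a.
Proof.
move=> [[P0 PD PM] P1 Pprime].
pose Pb : {pred A} := fun a => `[< P a >].
have PbE a : (a \in Pb) = `[< P a >] by [].
have id_closed : idealr_closed Pb.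
  split; rewrite ?PbE; [exact/asboolP|exact/asboolPn|].
  by move=> a u v /asboolP ? /asboolP ?; apply/asboolP; apply/PD => //; apply/PM.
have pr_closed : prime_idealr_closed Pb.
  by move=> u v /asboolP /Pprime [] ?; apply/orP; [left|right]; apply/asboolP.
pose m1 := isIdealr.Build A Pb id_closed.
pose m2 := isPrimeIdealrClosed.Build A Pb pr_closed.
pose PI : prime_idealr A := HB.pack Pb m1 m2.
pose Q := {ideal_quot PI}.
have [inv [invP inv_id]] := comring_inverse Q.
pose un : {pred Q} := [pred x | inv x * x == 1].
have mulVx : {in un, left_inverse 1 inv *%R} by move=> x /eqP.
have unitPl x y : y * x = 1 -> un x by move=> yx; apply/eqP/(invP x y).
have inv_out : {in [predC un], inv =1 id} by move=> x /eqP; apply: inv_id.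
pose u1 := GRing.ComNzRing_hasMulInverse.Build Q mulVx unitPl inv_out.
pose Q1 : comUnitRingType := HB.pack Q u1.
have domQ : GRing.integral_domain_axiom Q1 := @Quotient.rquot_IdomainAxiom A PI.
pose u2 := GRing.ComUnitRing_isIntegral.Build Q1 domQ.
pose Q2 : idomainType := HB.pack Q1 u2.
pose pi_Q : {rmorphism A -> Q} := (\pi_Q)%qT.
have pi0 a : pi_Q a = 0 <-> P a.
  rewrite -(rmorph0 pi_Q); split=> [/eqP|Pa]; last apply/eqP.
    by rewrite /pi_Q /= -Quotient.idealrBE subr0 => /asboolP.
  by rewrite /pi_Q /= -Quotient.idealrBE subr0; apply/asboolP.
exists {fraction Q2}, (@FracField.tofrac Q2 \o (pi_Q : {rmorphism A -> Q2})) => a.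
split => /= [/eqP|Pa]; first by rewrite tofrac_eq0 => /eqP /pi0.
by apply/eqP; rewrite tofrac_eq0; apply/eqP/pi0.
Qed.

(** [psi] is a generic point with coordinates in [L]. Adjoining these to [K] one at a time, the
    identity of [K] extends to a K-point that satisfies the same equations and avoids [q = 0]. *)
Lemma generic_point_specialization (K : closedFieldType) n (L : fieldType)
  (psi : {rmorphism {mpoly K[n]} -> L}) q : psi q != 0 ->
  exists a, (forall p, psi p = 0 -> p.@[a] = 0) /\ q.@[a] != 0.
Proof.
move=> q0.
pose psi0 : {rmorphism K -> L} := psi \o @mpolyC n K.
have [B [iota [Psi [b [PsiE bE ptE _]]]]] :=
  extension_tower K psi0 (fun i => psi 'X_i).
pose ev := mmap iota b.
have PsiEv p : Psi (ev p) = psi p.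
  rewrite rmorph_mmap [RHS]rmorph_mpolyE.
  by apply: eq_mmap => [c|i] /=; rewrite ?PsiE ?bE.
have [|q' q'0 H] := ptE (ev q); first by rewrite PsiEv.
have [||chi [chiE ker chiq]] := H idfun.
- by move=> a /eqP; rewrite fmorph_eq0 => /eqP.
- by apply: contraNneq q'0 => /= ->; rewrite raddf0.
have chiEv p : chi (ev p) = p.@[chi \o b].
  by rewrite rmorph_mmap; apply: eq_mmap => // c; rewrite /= chiE.
exists (chi \o b); split=> [p p0|]; last by rewrite -chiEv.
by rewrite -chiEv ker // PsiEv.
Qed.

Lemma mpoly_nonroot (K : closedFieldType) n (p : {mpoly K[n]}) :
  p != 0 -> exists a, p.@[a] != 0.
Proof.
move=> p0; pose psi : {rmorphism {mpoly K[n]} -> _} := @FracField.tofrac {mpoly K[n]}.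
have [|a [_ ?]] := @generic_point_specialization K n _ psi p; last by exists a.
by rewrite /= tofrac_eq0.
Qed.

(** An ideal maximal among those that contain [I] and avoid the powers of [q] is prime: adding
    either of two outside elements [a], [b] captures a power of [q], and the product of these powers
    lies in [P] plus the multiples of [a * b]. *)
Lemma ideal_avoiding_powers (A : comNzRingType) (I : set A) q : is_ideal I ->
  (forall k, ~ I (q ^+ k)) ->
  exists P, [/\ is_prime P, I `<=` P & ~ P q].
Proof.
move=> idI Iq.
pose good J := [/\ is_ideal J, I `<=` J & forall k, ~ J (q ^+ k)].
have [|P [PP maxP]] := @Zorn_bigcup A (fun J => J = set0 \/ good J).
  move=> F FP Ftot; case: (pselect (exists2 J, F J & J !=set0)) => [[J0 FJ0 J0n]|no].
    have goodF J x : F J -> J x -> good J.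
      by move=> FJ Jx; case: (FP _ FJ) => // J00; move: Jx; rewrite J00.
    have [x0 J0x0] := J0n; have [[J00 _ _] IJ0 _] := goodF _ _ FJ0 J0x0.
    right; split; last 2 first.
    - by move=> x Ix; exists J0 => //; apply: IJ0.
    - by move=> k [J FJ Jk]; have [_ _ /(_ k)] := goodF _ _ FJ Jk.
    split; first by exists J0.
      move=> a b [J FJ Ja] [J' FJ' J'b].
      have [JJ|JJ] := Ftot _ _ FJ FJ'.
        by exists J' => //; have [[_ + _] _ _] := goodF _ _ FJ' J'b; apply=> //; apply: JJ.
      by exists J => //; have [[_ + _] _ _] := goodF _ _ FJ Ja; apply=> //; apply: JJ.
    by move=> r a [J FJ Ja]; exists J => //; have [[_ _ +] _ _] := goodF _ _ FJ Ja; apply.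
  left; rewrite -subset0 => x [J FJ Jx]; case: no; exists J => //; by exists x.
have [I0 ID IM] := idI.
have {PP} [idP IP Pq] : good P.
  case: PP => // P0; have /maxP[] : P `<` I by rewrite P0; split=> // /(_ 0 I0).
  by right; split.
have [P0 PD PM] := idP.
have add a : ~ P a -> exists k p r, P p /\ q ^+ k = p + r * a.
  move=> Pa; pose J x := exists p r, P p /\ x = p + r * a.
  have PJ : P `<=` J by move=> x Px; exists x, 0; rewrite mul0r addr0.
  have idJ : is_ideal J.
    split; first exact: PJ.
      move=> _ _ [p [r [Pp ->]]] [p' [r' [Pp' ->]]]; exists (p + p'), (r + r').
      by split; [exact: PD|ring].
    move=> s _ [p [r [Pp ->]]]; exists (s * p), (s * r); split; [exact: PM|ring].
  apply: contrapT => no; apply: (maxP J).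
    split=> // /(_ a) JP; apply/Pa/JP; exists 0, 1; by rewrite add0r mul1r.
  right; split=> //; first by move=> x /IP /PJ.
  by move=> k [p [r Hp]]; apply: no; exists k, p, r.
exists P; split=> //; last by move=> ?; apply: (Pq 1%N).
split=> //; first by move=> P1; apply: (Pq 0%N).
move=> a b Pab; apply: contrapT => /not_orP[/add[k [p [r [Pp E]]]] /add[l [p' [s [Pp' E']]]]].
apply: (Pq (k + l)%N); rewrite exprD E E'.
have -> : (p + r * a) * (p' + s * b) = (p' + s * b) * p + r * a * p' + (r * s) * (a * b).
  by ring.
by apply/PD; [apply/PD|]; apply: PM.
Qed.

(** If no power of [q] lies in [I], some prime containing [I] avoids [q]. It gives a generic point,
    which specializes to a zero of [I] where [q] does not vanish. *)
Theorem nullstellensatz (K : closedFieldType) n (I : set {mpoly K[n]}) q :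
  is_ideal I -> (forall a, (forall p, I p -> p.@[a] = 0) -> q.@[a] = 0) ->
  exists k, I (q ^+ k).
Proof.
move=> idI qV; apply: contrapT => /forallNP Iq.
have [P [primeP IP Pq]] := ideal_avoiding_powers idI Iq.
have [L [psi psiP]] := prime_kernel primeP.
have [|a [aP qa]] := @generic_point_specialization K n L psi q.
  by apply/eqP => /psiP.
by move: qa; rewrite qV ?eqxx // => p /IP /psiP /aP.
Qed.

(** * Regular functions *)

Section Evaluation.
Variables (K : closedFieldType) (n : nat) (x : 'rV[K]_n).

Definition evalp : {mpoly K[n]} -> K := meval (x 0).
HB.instance Definition _ := GRing.RMorphism.copy evalp (meval (x 0)).

Lemma evalpE p : evalp p = peval p x. Proof. by []. Qed.

End Evaluation.

Lemma peval_mmap (K : closedFieldType) n m (g : 'I_n -> {mpoly K[m]})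
  (p : {mpoly K[n]}) (y : 'rV[K]_m) :
  peval (mmap (@mpolyC m K) g p) y = peval p (\row_j peval (g j) y).
Proof.
rewrite -evalpE (rmorph_mmap _ _ (evalp y)); apply: eq_mmap => [c|j] /=; first exact: mevalC.
by rewrite mxE.
Qed.

Section Vanishing.
Variables (K : closedFieldType) (n : nat).
Implicit Types (X S U : set 'rV[K]_n) (x : 'rV[K]_n) (p q : {mpoly K[n]}).

Lemma pevalD p q x : peval (p + q) x = peval p x + peval q x.
Proof. exact: mevalD. Qed.
Lemma pevalB p q x : peval (p - q) x = peval p x - peval q x.
Proof. exact: mevalB. Qed.
Lemma pevalM p q x : peval (p * q) x = peval p x * peval q x.
Proof. exact: mevalM. Qed.
Lemma pevalC c x : peval c%:MP x = c. Proof. exact: mevalC. Qed.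
Lemma peval0 x : peval 0 x = 0. Proof. exact: meval0. Qed.
Lemma peval1 x : peval 1 x = 1. Proof. exact: meval1. Qed.
Lemma pevalX i x : peval 'X_i x = x 0 i. Proof. exact: mevalXU. Qed.
Lemma pevalXn p k x : peval (p ^+ k) x = peval p x ^+ k.
Proof. exact: rmorphXn. Qed.
Lemma peval_prod (I : Type) (r : seq I) (P : pred I) F x :
  peval (\prod_(i <- r | P i) F i) x = \prod_(i <- r | P i) peval (F i) x.
Proof. exact: rmorph_prod. Qed.

Definition vanish S : set {mpoly K[n]} := [set p | forall x, S x -> peval p x = 0].

Lemma vanish_ideal S : is_ideal (vanish S).
Proof.
split=> [x _|a b Ha Hb x Sx|r a Ha x Sx]; first exact: peval0.
  by rewrite pevalD Ha // Hb // addr0.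
by rewrite pevalM Ha // mulr0.
Qed.

Lemma vanishS S T : S `<=` T -> vanish T `<=` vanish S.
Proof. by move=> ST p pT x /ST /pT. Qed.

Lemma zero_locus_vanish S : zariski_closed S -> zero_locus (vanish S) = S.
Proof.
move=> [I SE]; apply/seteqP; split=> [x xS|x Sx p]; last by apply.
by rewrite SE => p Ip; apply: xS => y; rewrite SE => /(_ _ Ip).
Qed.

Lemma notin_closed S x : zariski_closed S -> ~ S x ->
  exists2 p, vanish S p & peval p x != 0.
Proof.
move=> /zero_locus_vanish SE; rewrite -{1}SE => /existsNP[p /not_implyP[Vp px]].
by exists p => //; apply/eqP.
Qed.

Lemma zero_locus_closed (I : set {mpoly K[n]}) : zariski_closed (zero_locus I).
Proof. by exists I. Qed.

Lemma affine_variety_prime X : affine_variety X -> is_prime (vanish X).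
Proof.
move=> [_ [[x Xx] irr]]; split; first exact: vanish_ideal.
  by move=> /(_ x Xx) /eqP; rewrite peval1 oner_eq0.
move=> a b ab.
have [] := irr (zero_locus [set a]) (zero_locus [set b]).
- exact: zero_locus_closed.
- exact: zero_locus_closed.
- move=> y Xy; have /eqP := ab y Xy; rewrite pevalM mulf_eq0.
  by move=> /orP[/eqP H|/eqP H]; [left|right] => _ ->.
- by move=> H; left => y /H; apply.
by move=> H; right => y /H; apply.
Qed.

Lemma prime_affine_variety X : zariski_closed X -> X !=set0 ->
  (forall p q, vanish X (p * q) -> vanish X p \/ vanish X q) -> affine_variety X.
Proof.
move=> clX X0 pr; split=> //; split=> // A B clA clB XAB.
apply: contrapT => /not_orP[/existsNP[x /not_implyP[Xx Ax]]].
move=> /existsNP[y /not_implyP[Xy By]].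
have [p pA px] := notin_closed clA Ax; have [q qB qy] := notin_closed clB By.
have [z /XAB[/pA|/qB] z0|pX|qX] := pr p q; first by rewrite pevalM z0 mul0r.
- by rewrite pevalM z0 mulr0.
- by move: px; rewrite pX ?eqxx.
- by move: qy; rewrite qX ?eqxx.
Qed.

Lemma vanish_open X h p : affine_variety X -> ~ vanish X h ->
  (forall x, X x -> peval h x != 0 -> peval p x = 0) -> vanish X p.
Proof.
move=> /affine_variety_prime [_ _ pr] hX H.
have [x Xx|//|//] := pr h p.
rewrite pevalM; have [->|/(H _ Xx) ->] := eqVneq (peval h x) 0; rewrite ?mul0r ?mulr0 //.
Qed.

Lemma not_vanish S p : ~ vanish S p <-> exists2 x, S x & peval p x != 0.
Proof.
split=> [/existsNP[x /not_implyP[Sx /eqP px]]|[x Sx px] /(_ x Sx) p0]; first by exists x.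
by rewrite p0 eqxx in px.
Qed.

End Vanishing.

Section Regular.
Variables (K : closedFieldType).

(** The neighbourhood shrinks to the nonvanishing set of a denominator: multiply numerator and
    denominator by an equation of the removed closed set that is nonzero at [x]. *)
Lemma regular_onP n (U : set 'rV[K]_n) f : regular_on U f <->
  forall x, U x -> exists p q, peval q x != 0 /\
    forall y, U y -> peval q y != 0 -> f y = peval p y / peval q y.
Proof.
split=> H x Ux.
  have [V [p [q [[C clC VE] Vx Hpq]]]] := H x Ux.
  have Cx : ~ C x by move: Vx; rewrite VE => -[].
  have [c cC cx] := notin_closed clC Cx.
  exists (p * c), (q * c); split; first by rewrite pevalM mulf_neq0 // (Hpq _ Vx).1.
  move=> y Uy; rewrite !pevalM mulf_eq0 negb_or => /andP[qy cy].
  have Vy : V y by rewrite VE; split=> // /cC c0; rewrite c0 eqxx in cy.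
  by rewrite (Hpq _ Vy).2 -mulf_div divff // mulr1.
have [p [q [qx Hpq]]] := H x Ux.
exists (U `\` zero_locus [set q]), p, q; split.
- by exists (zero_locus [set q]) => //; exact: zero_locus_closed.
- by split=> // /(_ q erefl) q0; rewrite q0 eqxx in qx.
move=> y [Uy qy].
have qy0 : peval q y != 0 by apply/eqP => q0; apply: qy => _ ->.
by split=> //; apply: Hpq.
Qed.

Section Closure.
Variables (n : nat) (U : set 'rV[K]_n).
Implicit Types (f g : 'rV[K]_n -> K).

Lemma regular_ext f g : regular_on U f -> (forall x, U x -> f x = g x) -> regular_on U g.
Proof.
move=> /regular_onP H fg; apply/regular_onP => x Ux.
have [p [q [qx Hpq]]] := H x Ux; exists p, q; split=> // y Uy qy.
by rewrite -fg // Hpq.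
Qed.

Lemma regular_peval p : regular_on U (peval p).
Proof.
apply/regular_onP => x Ux; exists p, 1; split=> [|y Uy _]; first by rewrite peval1 oner_eq0.
by rewrite peval1 divr1.
Qed.

Lemma regular_cst c : regular_on U (fun=> c).
Proof. by apply: (regular_ext (regular_peval c%:MP)) => x _; rewrite pevalC. Qed.

Lemma regular_coord j : regular_on U (fun x => x 0 j).
Proof. by apply: (regular_ext (regular_peval 'X_j)) => x _; rewrite pevalX. Qed.

Lemma regularD f g : regular_on U f -> regular_on U g ->
  regular_on U (fun x => f x + g x).
Proof.
move=> /regular_onP Hf /regular_onP Hg; apply/regular_onP => x Ux.
have [p [q [qx Hpq]]] := Hf x Ux; have [r [s [sx Hrs]]] := Hg x Ux.
exists (p * s + r * q), (q * s); split; first by rewrite pevalM mulf_neq0.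
move=> y Uy; rewrite pevalM mulf_eq0 negb_or => /andP[qy sy].
by rewrite Hpq // Hrs // pevalD !pevalM addf_div.
Qed.

Lemma regularM f g : regular_on U f -> regular_on U g ->
  regular_on U (fun x => f x * g x).
Proof.
move=> /regular_onP Hf /regular_onP Hg; apply/regular_onP => x Ux.
have [p [q [qx Hpq]]] := Hf x Ux; have [r [s [sx Hrs]]] := Hg x Ux.
exists (p * r), (q * s); split; first by rewrite pevalM mulf_neq0.
move=> y Uy; rewrite pevalM mulf_eq0 negb_or => /andP[qy sy].
by rewrite Hpq // Hrs // !pevalM mulf_div.
Qed.

Lemma regularV f : regular_on U f -> (forall x, U x -> f x != 0) ->
  regular_on U (fun x => (f x)^-1).
Proof.
move=> /regular_onP Hf f0; apply/regular_onP => x Ux.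
have [p [q [qx Hpq]]] := Hf x Ux.
have px : peval p x != 0.
  by have := f0 x Ux; rewrite Hpq // mulf_eq0 negb_or => /andP[].
exists (q * q), (p * q); split; first by rewrite pevalM mulf_neq0.
move=> y Uy; rewrite pevalM mulf_eq0 negb_or => /andP[py qy].
by rewrite Hpq // !pevalM invf_div -mulf_div divff // mulr1.
Qed.

Lemma regularX f k : regular_on U f -> regular_on U (fun x => f x ^+ k).
Proof.
move=> fr; elim: k => [|k IH]; first exact: regular_cst.
by apply: (regular_ext (regularM fr IH)) => x _; rewrite exprS.
Qed.

Lemma regular_sum (I : Type) (r : seq I) (P : pred I) F :
  (forall i, regular_on U (F i)) -> regular_on U (fun x => \sum_(i <- r | P i) F i x).
Proof.
move=> HF; elim: r => [|i r IH].
  by apply: (regular_ext (regular_cst 0)) => x _; rewrite big_nil.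
case Pi: (P i); last by apply: (regular_ext IH) => x _; rewrite big_cons Pi.
by apply: (regular_ext (regularD (HF i) IH)) => x _; rewrite big_cons Pi.
Qed.

End Closure.

Lemma regular_peval_comp n m (U : set 'rV[K]_n) (g : 'rV[K]_n -> 'rV[K]_m) p :
  (forall j, regular_on U (fun x => g x 0 j)) -> regular_on U (fun x => peval p (g x)).
Proof.
move=> gr; elim/mpoly_ring_ind: p => [c|i|p q Hp Hq|p q Hp Hq].
- by apply: (regular_ext (@regular_cst _ U c)) => x _; rewrite pevalC.
- by apply: (regular_ext (gr i)) => x _; rewrite pevalX.
- by apply: (regular_ext (regularD Hp Hq)) => x _; rewrite pevalD.
by apply: (regular_ext (regularM Hp Hq)) => x _; rewrite pevalM.
Qed.

Lemma regular_horner n m (U : set 'rV[K]_n) (g : 'rV[K]_n -> 'rV[K]_m)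
  (p : {poly {mpoly K[m]}}) f : (forall j, regular_on U (fun x => g x 0 j)) ->
  regular_on U f -> regular_on U (fun x => (map_poly (evalp (g x)) p).[f x]).
Proof.
move=> gr fr.
have H : regular_on U (fun x => \sum_(i < size p) peval p`_i (g x) * f x ^+ i).
  apply: regular_sum => i; apply: regularM; first exact: regular_peval_comp.
  exact: regularX.
apply: (regular_ext H) => x _.
rewrite [RHS](@horner_coef_wide _ (size p)) ?size_poly //.
by apply: eq_bigr => i _; rewrite coef_map.
Qed.

Lemma regular_comp n m (U : set 'rV[K]_n) (W : set 'rV[K]_m)
  (g : 'rV[K]_n -> 'rV[K]_m) f :
  (forall x, U x -> W (g x)) -> (forall j, regular_on U (fun x => g x 0 j)) ->
  regular_on W f -> regular_on U (fun x => f (g x)).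
Proof.
move=> UW gr /regular_onP Hf; apply/regular_onP => x Ux.
have [p [q [qx Hpq]]] := Hf _ (UW _ Ux).
have /regular_onP/(_ x Ux)[a [b [bx Hab]]] := regular_peval_comp p gr.
have /regular_onP/(_ x Ux)[c [e [ex Hce]]] := regular_peval_comp q gr.
have cx : peval c x != 0.
  by move: qx; rewrite Hce // mulf_eq0 negb_or => /andP[].
exists (a * e * e), (b * c * e); split; first by rewrite !pevalM !mulf_neq0.
move=> y Uy; rewrite !pevalM !mulf_eq0 !negb_or => /andP[/andP[b0 c0] e0].
have qy : peval q (g y) != 0 by rewrite Hce // mulf_neq0 // invr_eq0.
rewrite Hpq //; last exact: UW.
by rewrite Hab // Hce // invf_div mulf_div -[RHS]mulf_div divff // mulr1.
Qed.

(* The denominators of [f] generate an ideal with zero locus inside that of [h]. *)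
Lemma regular_principal_open n (X : set 'rV[K]_n) h f : zariski_closed X ->
  regular_on [set x | X x /\ peval h x != 0] f ->
  exists p N, forall x, X x -> peval h x != 0 -> f x = peval p x / peval h x ^+ N.
Proof.
move=> clX /regular_onP Hf.
pose I : set {mpoly K[n]} := [set q | exists p, forall x, X x -> peval h x != 0 ->
   peval q x * f x = peval p x].
have [|a Ia|k [p Hp]] := @nullstellensatz K n I h.
- split; first by exists 0 => x _ _; rewrite peval0 mul0r.
    move=> a b [p Hp] [q Hq]; exists (p + q) => x Xx hx.
    by rewrite !pevalD mulrDl Hp // Hq.
  move=> r a [p Hp]; exists (r * p) => x Xx hx.
  by rewrite !pevalM -mulrA Hp.
- pose x : 'rV[K]_n := \row_i a i.
  have aE p : p.@[a] = peval p x by apply: meval_eq => i; rewrite mxE.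
  have Xx : X x.
    rewrite -(zero_locus_vanish clX) => p Xp; rewrite -aE; apply: Ia.
    by exists 0 => y Xy _; rewrite Xp // mul0r peval0.
  apply/eqP; apply/negPn/negP; rewrite aE => hx.
  have [p [q [qx Hpq]]] := Hf x (conj Xx hx).
  (* [f = p / q] is known only where [q] is nonzero; with the square, [q * q * f = q * p] holds
     where [q] vanishes as well. *)
  suff q0 : peval (q * q) x = 0 by move: q0 qx; rewrite pevalM => /eqP; rewrite mulf_eq0 orbb => ->.
  rewrite -aE; apply: Ia; exists (q * p) => y Xy hy; rewrite !pevalM.
  have [->|qy] := eqVneq (peval q y) 0; first by rewrite !mul0r.
  by rewrite Hpq // -mulrA [X in _ * X]mulrC divfK.
exists p, k => x Xx hx; by rewrite -Hp // pevalXn mulrC mulKf // expf_neq0.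
Qed.

End Regular.

(** * Tangent spaces and minors *)

Section RankMinors.

Lemma rank_rowsub_free (E : fieldType) m n (A : 'M[E]_(m, n)) r :
  \rank A = r -> exists f : 'I_r -> 'I_m, row_free (rowsub f A).
Proof. by move=> <-; exists (maxrankfun A); apply: maxrowsub_free. Qed.

Lemma nonzero_minor (E : fieldType) m n (A : 'M[E]_(m, n)) :
  exists (f : 'I_(\rank A) -> 'I_m) (g : 'I_(\rank A) -> 'I_n),
    \det (mxsub f g A) != 0.
Proof.
pose f := maxrankfun A; pose B := rowsub f A.
have rB : \rank B^T = \rank A by rewrite mxrank_tr eq_maxrowsub.
have [g gE] := rank_rowsub_free rB.
exists f, g; rewrite -det_tr -unitfE -unitmxE -row_free_unit.
by rewrite (_ : (mxsub f g A)^T = rowsub g B^T) // -trmx_mxsub -mxsub_comp.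
Qed.

Lemma minor_rank (E : fieldType) m n (A : 'M[E]_(m, n)) r
  (f : 'I_r -> 'I_m) (g : 'I_r -> 'I_n) : \det (mxsub f g A) != 0 -> (r <= \rank A)%N.
Proof.
rewrite -unitfE -unitmxE -row_free_unit /row_free => /eqP <-.
have -> : mxsub f g A = (rowsub g (rowsub f A)^T)^T.
  by apply/matrixP => i j; rewrite !mxE.
rewrite mxrank_tr (leq_trans (mxrankS (rowsub_sub _ _))) // mxrank_tr.
exact/mxrankS/rowsub_sub.
Qed.

(** [b] is a minor whose size is the rank over [E]; where it survives, the other rank is at least
    that size. *)
Lemma rank_specialize (A : comNzRingType) (E F : fieldType) (al : {rmorphism A -> E})
  (be : {rmorphism A -> F}) m n (M : 'M[A]_(m, n)) :
  exists2 b, al b != 0 & be b != 0 -> (\rank (map_mx al M) <= \rank (map_mx be M))%N.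
Proof.
have [f [g fg]] := nonzero_minor (map_mx al M).
exists (\det (mxsub f g M)); first by rewrite -det_map_mx map_mxsub.
by rewrite -det_map_mx map_mxsub; apply: minor_rank.
Qed.

End RankMinors.

Section LinearSets.
Variables (K : closedFieldType) (n : nat).

Lemma linear_dimP (T : set 'rV[K]_n) e : linear_dim T e <->
  exists2 M : 'M[K]_(e, n), row_free M & forall v, T v <-> (v <= M)%MS.
Proof.
split=> [[W [TE We]]|[M Mfree TE]].
  pose b := vbasis W; pose M : 'M[K]_(\dim W, n) := \matrix_i b`_i.
  have mulM (c : 'rV_(\dim W)) : c *m M = \sum_i c 0 i *: b`_i.
    by rewrite mulmx_sum_row; apply: eq_bigr => i _; rewrite rowK.
  rewrite -We; exists M.
    apply/inj_row_free => c; rewrite mulM => /freeP c0; apply/rowP => i.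
    by rewrite mxE c0 // (basis_free (vbasisP W)).
  move=> v; rewrite TE; split=> [vW|/submxP[c ->]] /=.
    have /coord_span -> : v \in <<b>>%VS by rewrite (span_basis (vbasisP W)).
    apply/submxP; exists (\row_i coord b i v); rewrite mulM.
    by apply: eq_bigr => i _; rewrite mxE.
  rewrite mulM; apply: memv_suml => i _; apply/memvZ/vbasis_mem/mem_nth.
  by rewrite size_tuple.
pose b := [tuple row i M | i < e]; exists <<b>>%VS.
have bE (i : 'I_e) : b`_i = row i M.
  by rewrite -tnth_nth tnth_mktuple.
have mulM (c : 'rV_e) : c *m M = \sum_i c 0 i *: b`_i.
  by rewrite mulmx_sum_row; apply: eq_bigr => i _; rewrite bE.
split.
  apply/seteqP; split=> v /= => [/TE/submxP[c ->]|vb]; last apply/TE.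
    rewrite mulM; apply: memv_suml => i _; apply/memvZ/memv_span/mem_nth.
    by rewrite size_tuple.
  have E : v = \sum_(i < e) coord b i v *: b`_i := @coord_span _ _ e b v vb.
  apply/submxP; exists (\row_i coord b i v); rewrite mulM {1}E.
  by apply: eq_bigr => i _; rewrite mxE.
suff : free b by move/eqP => ->; rewrite size_tuple.
apply/freeP => k kb i; have : (\row_j k j) *m M = 0.
  by rewrite mulM -[RHS]kb; apply: eq_bigr => j _; rewrite mxE.
by move/eqP; rewrite mulmx_free_eq0 // => /eqP /rowP /(_ i); rewrite !mxE.
Qed.

(** Rows in [T] of the largest possible rank: a further vector of [T] cannot enlarge their span. *)
Lemma finite_span (T : set 'rV[K]_n) : exists m (V : 'M[K]_(m, n)),
  (forall i, T (row i V)) /\ forall v, T v -> (v <= V)%MS.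
Proof.
pose Q k := `[< exists m (V : 'M[K]_(m, n)), (forall i, T (row i V)) /\ \rank V = k >].
have exQ : exists k, Q k.
  by exists (\rank (0 : 'M[K]_(0, n))); apply/asboolP; exists 0%N, 0; split=> // -[].
have ubQ k : Q k -> (k <= n)%N by move=> /asboolP[m [V [_ <-]]]; apply: rank_leq_col.
case: (ex_maxnP exQ ubQ) => k /asboolP[m [V [VT rk]]] maxk.
exists m, V; split=> // v Tv.
have rv : (\rank (col_mx V v) <= \rank V)%N.
  rewrite rk; apply: maxk; apply/asboolP; exists (m + 1)%N, (col_mx V v); split=> // i.
  by case: (split_ordP i) => j ->; rewrite ?col_mxKu (rowKu, rowKd) // ord1 row_id.
have [_ E] := mxrank_leqif_sup (addsmxSl V v).
apply: submx_trans (addsmxSr V v) _.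
by rewrite -E eqn_leq mxrankS ?addsmxSl //= addsmxE.
Qed.

Lemma linear_spanP (T : set 'rV[K]_n) v : linear_span T v <->
  exists m (M : 'M[K]_(m, n)), (forall i, T (row i M)) /\ (v <= M)%MS.
Proof.
split=> [[s [sT vs]]|[m [M [MT /submxP[c ->]]]]].
  exists (size s), (\matrix_i s`_i); split=> [i|].
    by rewrite rowK; apply/sT/mem_nth.
  have := @coord_span _ _ _ (in_tuple s) v vs => ->.
  apply/submxP; exists (\row_i coord (in_tuple s) i v); rewrite mulmx_sum_row.
  by apply: eq_bigr => i _; rewrite rowK mxE.
exists [seq row i M | i <- enum 'I_m]; split=> [w /mapP[i _ ->]|]; first exact: MT.
rewrite mulmx_sum_row; apply: memv_suml => i _; apply/memvZ/memv_span/map_f.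
by rewrite mem_enum.
Qed.

End LinearSets.

Section Tangent.
Variables (K : closedFieldType) (n : nat).
Implicit Types (S X : set 'rV[K]_n) (x v : 'rV[K]_n).

Definition dpeval (p : {mpoly K[n]}) x v : K := \sum_i peval p^`M(i) x * v 0 i.

Definition jacmx (R : comNzRingType) m k (r : 'I_m -> {mpoly R[k]}) : 'M[{mpoly R[k]}]_(m, k) :=
  \matrix_(i, j) (r i)^`M(j).

Lemma dpevalE m (r : 'I_m -> {mpoly K[n]}) x v i :
  dpeval (r i) x v = (v *m (map_mx (evalp x) (jacmx r))^T) 0 i.
Proof. by rewrite mxE; apply: eq_bigr => j _; rewrite !mxE mulrC. Qed.

(** The gradients at [x] of all equations span a finite-dimensional space, so finitely many
    equations cut out the tangent space. *)
Lemma tangent_equations S x : exists m (r : 'I_m -> {mpoly K[n]}),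
  (forall k, vanish S (r k)) /\
  forall v, tangent_space S x v <-> (v <= kermx (map_mx (evalp x) (jacmx r))^T)%MS.
Proof.
have [m [M [MT TM]]] := finite_span
  [set w | exists2 p, vanish S p & w = \row_j peval p^`M(j) x].
have {MT} MT k : exists p, vanish S p /\ row k M = \row_j peval p^`M(j) x.
  by have [p pS pE] := MT k; exists p.
have [r rP] := choice MT.
have ME : map_mx (evalp x) (jacmx r) = M.
  apply/row_matrixP => k; rewrite (rP k).2; apply/rowP => j.
  by rewrite !mxE.
exists m, r; split=> [k|v]; first exact: (rP k).1.
split=> [tv|/sub_kermxP vr p pS].
  by apply/sub_kermxP/rowP => i; rewrite -dpevalE mxE; exact: (tv _ (rP i).1).
have /submxP[c cE] : (\row_j peval p^`M(j) x <= M)%MS by apply: TM; exists p.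
change (dpeval p x v = 0); rewrite (@dpevalE 1 (fun=> p) x v 0).
have -> : map_mx (evalp x) (jacmx (fun _ : 'I_1 => p)) = c *m M.
  by rewrite -cE; apply/matrixP => i j; rewrite !mxE.
by rewrite trmx_mul mulmxA -ME vr mul0mx mxE.
Qed.

End Tangent.

(** * Algebraic independence and dimension *)

Definition mcomp (K : closedFieldType) n m (g : 'I_n -> {mpoly K[m]}) :
  {mpoly K[n]} -> {mpoly K[m]} := mmap (@mpolyC m K) g.
HB.instance Definition _ (K : closedFieldType) n m (g : 'I_n -> {mpoly K[m]}) :=
  GRing.RMorphism.copy (mcomp g) (mmap (@mpolyC m K) g).

Section Composition.
Variables (K : closedFieldType) (n m : nat) (g : 'I_n -> {mpoly K[m]}).

Definition pmap (y : 'rV[K]_m) : 'rV[K]_n := \row_j peval (g j) y.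

Lemma peval_mcomp p y : peval (mcomp g p) y = peval p (pmap y).
Proof. exact: peval_mmap. Qed.

Lemma mcompC c : mcomp g c%:MP = c%:MP. Proof. exact: mmapC. Qed.
Lemma mcompX i : mcomp g 'X_i = g i. Proof. by rewrite [LHS]mmapX mmap1U. Qed.

Lemma mderiv_mcomp p j :
  (mcomp g p)^`M(j) = \sum_i mcomp g p^`M(i) * (g i)^`M(j).
Proof.
have := @chain_rule n K _ _ (@mpolyC m K) g idfun (mderiv j).
apply=> [a b|c] /=; last exact: mderivC.
by rewrite mderivM addrC mulrC [X in _ + X]mulrC addrC.
Qed.

End Composition.

Section Dimension.
Variables (K : closedFieldType) (charK : [pchar K] =i pred0).

Definition indep_on n (S : set 'rV[K]_n) e (u : 'I_e -> {mpoly K[n]}) :=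
  forall F : {mpoly K[e]}, vanish S (mcomp u F) -> F = 0.

Lemma indep_onS n (S T : set 'rV[K]_n) e (u : 'I_e -> {mpoly K[n]}) :
  S `<=` T -> indep_on S u -> indep_on T u.
Proof. by move=> ST uS F /(vanishS ST) /uS. Qed.

(** Over a field [L] containing the coordinate ring of [X], the derivations dual to [u] are [e]
    independent vectors killed by the Jacobian matrix of the equations. The rank of this matrix at
    [x] is at most its rank over [L], so its kernel at [x] has dimension at least [e]. *)
Lemma indep_le_tangent n (X : set 'rV[K]_n) e (u : 'I_e -> {mpoly K[n]}) x d
  (M : 'M[K]_(d, n)) : affine_variety X -> indep_on X u -> X x ->
  (forall v, tangent_space X x v <-> (v <= M)%MS) -> (e <= \rank M)%N.
Proof.
move=> hX uX Xx TM.
have [L [psi psiP]] := prime_kernel (affine_variety_prime hX).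
pose f : {rmorphism K -> L} := psi \o @mpolyC n K.
pose g i := psi 'X_i.
have psiE r : mmap f g r = psi r by rewrite [RHS]rmorph_mpolyE.
have [|v [vr vu]] := @dual_derivations K L f charK n g e u.
  move=> F F0; apply/uX/psiP; rewrite /mcomp rmorph_mmap -[RHS]F0.
  by apply: eq_mmap => // k; rewrite /= psiE.
pose V : 'M[L]_(e, n) := \matrix_(i, j) v i j.
have [m [r [rX rT]]] := tangent_equations X x.
have VG : V *m (map_mx psi (jacmx r))^T = 0.
  apply/matrixP => i k; rewrite !mxE -[RHS](vr (r k) i) ?psiE; last exact/psiP.
  by apply: eq_bigr => j _; rewrite !mxE psiE mulrC.
have rV : \rank V = e.
  apply/eqP; rewrite -/(row_free V); apply/row_freeP.
  exists (\matrix_(j, k) psi (u k)^`M(j)); apply/matrixP => i k; rewrite !mxE eq_sym -(vu k i).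
  by apply: eq_bigr => j _; rewrite !mxE psiE mulrC.
have := mulmx0_rank_max VG; rewrite mxrank_tr rV.
(* A minor nonzero at the point [x] of [X] is not in [vanish X], so it survives in [L]. *)
have [b bx /(_ _)/wrap[|rk]] := rank_specialize (evalp x) psi (jacmx r).
  by apply/eqP => /psiP /(_ x Xx); apply/eqP.
have -> : \rank M = (n - \rank (map_mx (evalp x) (jacmx r)))%N.
  rewrite -[\rank (map_mx _ _)]mxrank_tr -mxrank_ker.
  apply/eqmx_rank/andP; split; apply/rV_subP => w; first by move/TM/rT.
  by move/rT/TM.
by move=> H; rewrite leq_subRL ?rank_leq_col // addnC (leq_trans _ H) // leq_add2l.
Qed.

(** A relation is read as a polynomial in [p] over polynomials in [u]. On [S] only its constant term
    remains, which is zero by independence there; primeness cancels one factor [p], and the argument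
    repeats. *)
Lemma indep_cons n (S T : set 'rV[K]_n) e (u : 'I_e -> {mpoly K[n]}) p :
  S `<=` T -> is_prime (vanish T) -> indep_on S u -> vanish S p -> ~ vanish T p ->
  indep_on T (fun i => if unlift ord0 i is Some j then u j else p).
Proof.
move=> ST [_ _ prT] uS pS pT F; set u' := fun i => _.
pose y (i : 'I_e.+1) : {poly {mpoly K[e]}} :=
  if unlift ord0 i is Some j then ('X_j)%:P else 'X.
pose G := mmap (polyC \o @mpolyC e K) y F.
have evalG m (w : 'I_e.+1 -> {mpoly K[m]}) :
    mcomp w F = pev (mcomp (fun j => w (lift ord0 j))) (w ord0) G.
  rewrite /G rmorph_mmap; apply: eq_mmap => [c|i] /=; first by rewrite pevC /= mcompC.
  by rewrite /y; case: unliftP => [j|] -> /=; rewrite ?pevX // pevC /= mcompX.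
have polyG : forall H, vanish T (pev (mcomp u) p H) -> H = 0.
  elim/poly_ind => // H c IH Hc.
  have c0 : c = 0.
    apply: uS => x Sx; have := Hc x (ST _ Sx).
    by rewrite rmorphD rmorphM /= pevX pevC pevalD pevalM (pS x Sx) mulr0 add0r.
  move: Hc; rewrite c0 addr0 rmorphM /= pevX => /prT[/IH ->|//].
  by rewrite mul0r.
move=> FT; have G0 : G = 0.
  apply: polyG; move: FT; rewrite evalG /u' unlift_none.
  by congr (vanish T (pev (mcomp _) p G)); apply: funext => j; rewrite liftK.
have := evalG _ (fun i => 'X_i); rewrite G0 raddf0 => <-.
rewrite -[in LHS](comp_mpoly_id F) /comp_mpoly; apply: eq_mmap => // i.
by rewrite tnth_mktuple.
Qed.

(** Going up the chain, each strict inclusion supplies a function that vanishes on the smaller set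
    but not on the larger one, and it joins the earlier functions. *)
Lemma krull_indep n (X : set 'rV[K]_n) d : krull_dim X d ->
  exists u : 'I_d -> {mpoly K[n]}, indep_on X u.
Proof.
move=> [[F [Fvar Fprop]] _].
have step i : (i <= d)%N -> exists u : 'I_i -> {mpoly K[n]}, indep_on (F i) u.
  elim: i => [|i IH] id.
    have [[_ [[x Fx] _]] _] := Fvar 0%N id.
    exists (fun=> 0) => G G0; have GC : G = (G@_0)%:MP.
      elim/mpoly_ring_ind: G {G0} => [c|[]//|p q Hp Hq|p q Hp Hq].
      - by rewrite mcoeffC eqxx mulr1.
      - by rewrite Hp Hq -mpolyCD mcoeffC eqxx mulr1.
      - by rewrite Hp Hq -mpolyCM mcoeffC eqxx mulr1.
    by have := G0 x Fx; rewrite GC mcompC pevalC => ->; rewrite mpolyC0.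
  have [u uF] := IH (ltnW id).
  have [Fi FS] := Fprop i id.
  have [[clF _] _] := Fvar i (ltnW id).
  have /existsNP[x /not_implyP[FSx Fix]] := FS.
  have [p pF px] := notin_closed clF Fix.
  exists (fun k => if unlift ord0 k is Some j then u j else p).
  apply: (indep_cons Fi) => //; first exact: affine_variety_prime (Fvar _ id).1.
  by move/(_ x FSx) => p0; rewrite p0 eqxx in px.
have [u uF] := step d (leqnn d); exists u.
exact: indep_onS (Fvar d (leqnn d)).2 uF.
Qed.

(** Differentiating [mcomp u F = 0] gives a linear relation between independent rows, so the partial
    derivatives of [F] are relations of lower degree. By induction they are zero, and in
    characteristic zero [F] is then constant. *)
Lemma jacobian_indep s e (u : 'I_e -> {mpoly K[s]}) t :
  row_free (map_mx (evalp t) (jacmx u)) -> forall F, mcomp u F = 0 -> F = 0.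
Proof.
move=> /eqP free.
have [b bt] := rank_specialize (evalp t) (@FracField.tofrac {mpoly K[s]}) (jacmx u).
rewrite free tofrac_eq0 => /(_ _)/wrap[|rk]; first by apply: contraNneq bt => ->; rewrite raddf0.
have {rk} freeL : row_free (map_mx (@FracField.tofrac {mpoly K[s]}) (jacmx u)).
  by rewrite /row_free eqn_leq rank_leq_row.
suff H N F : (forall m, m \in msupp F -> (mdeg m < N)%N) -> mcomp u F = 0 -> F = 0.
  by move=> F; apply: (H (msize F)) => m; apply: msize_mdeg_lt.
elim: N F => [F F0 _|N IH F FN F0].
  by apply/eqP; rewrite -msupp_eq0; case: (msupp F) F0 => // m r /(_ m (mem_head _ _)).
have dF k : F^`M(k) = 0.
  apply: IH.
    move=> m; rewrite mcoeff_msupp mcoeff_mderiv => mF.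
    have : (m + U_(k))%MM \in msupp F.
      by rewrite mcoeff_msupp; apply: contraNneq mF => ->; rewrite mul0rn.
    by move/FN; rewrite mdegD mdeg1 addn1 ltnS.
  pose w : 'rV_e := \row_k FracField.tofrac (mcomp u F^`M(k)).
  have : w *m map_mx (@FracField.tofrac {mpoly K[s]}) (jacmx u) = 0.
    apply/rowP => j; rewrite !mxE.
    have := congr1 (@FracField.tofrac _) (congr1 (mderiv j) F0).
    rewrite mderiv_mcomp raddf0 tofrac0 => E; rewrite -[RHS]E rmorph_sum.
    by apply: eq_bigr => i _; rewrite !mxE rmorphM.
  move/eqP; rewrite mulmx_free_eq0 // => /eqP/rowP/(_ k); rewrite !mxE => /eqP.
  by rewrite tofrac_eq0 => /eqP.
have FC : F = (F@_0)%:MP.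
  apply/mpolyP => m; rewrite mcoeffC; case: eqP => [->|/eqP]; first by rewrite mulr1.
  rewrite eq_sym mulr0 => m0.
  have [k mk] : exists k, m k != 0%N.
    apply/existsP; rewrite -negb_forall; apply: contra m0 => /forallP m0.
    by apply/eqP/mnmP => k; rewrite mnm0E (eqP (m0 k)).
  have mE : m = ((m - U_(k)) + U_(k))%MM.
    by apply/mnmP => i; rewrite mnmDE mnmBE mnm1E; case: eqP => [<-|]; rewrite ?subnK ?lt0n //= subn0 addn0.
  have := congr1 (mcoeff (m - U_(k))%MM) (dF k).
  rewrite mcoeff_mderiv -mE mcoeff0 => /eqP.
  by rewrite -mulr_natr mulf_eq0 => /orP[/eqP //|]; rewrite ((pcharf0P K).1 charK).
by move: F0; rewrite FC mcompC => /eqP; rewrite mpolyC_eq0 => /eqP ->.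
Qed.

(* A parametrization [Phi] of part of [X] whose differential has full rank at one
   point is dominant: the missing functions would raise the dimension. *)
Lemma dominant_of_rank n (X : set 'rV[K]_n) s (Phi : 'I_n -> {mpoly K[s]}) x t d
  (M : 'M[K]_(d, n)) :
  affine_variety X -> X x -> (forall v, tangent_space X x v <-> (v <= M)%MS) ->
  (forall t, X (pmap Phi t)) ->
  (d <= \rank (map_mx (evalp t) (jacmx Phi)))%N ->
  forall p, mcomp Phi p = 0 -> vanish X p.
Proof.
move=> hX Xx TM PhiX rk p p0; apply: contrapT => pX.
set r := \rank _ in rk.
have [f ff] := rank_rowsub_free (erefl r).
(* Coordinates whose rows of the Jacobian are independent at [t]: they are independent on the image
   of [Phi], where [p] vanishes, so on [X] they and [p] are more than [d] independent functions. *)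
pose u k : {mpoly K[n]} := 'X_(f k).
have uY : indep_on (range (pmap Phi)) u.
  move=> F FY; apply: (@jacobian_indep _ _ (fun k => Phi (f k)) t).
    rewrite (_ : map_mx _ _ = rowsub f (map_mx (evalp t) (jacmx Phi))) //.
    by apply/matrixP => i j; rewrite !mxE.
  apply/eqP/negPn/negP => /mpoly_nonroot[a]; apply/negP/negPn/eqP.
  have -> : (mcomp (fun k => Phi (f k)) F).@[a] =
            peval (mcomp u F) (pmap Phi (\row_i a i)).
    rewrite peval_mcomp; have -> : pmap u (pmap Phi (\row_i a i)) =
       pmap (fun k => Phi (f k)) (\row_i a i).
      by apply/rowP => k; rewrite !mxE /u pevalX mxE.
    by rewrite -peval_mcomp; apply: meval_eq => i; rewrite mxE.
  by apply: FY; exists (\row_i a i).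
have := @indep_cons _ _ X _ u p _ (affine_variety_prime hX) uY _ pX.
move=> /(_ _ _)/wrap[_ [t' _ <-] //|_ [t' _ <-]|].
  by rewrite -peval_mcomp p0 peval0.
move=> /(indep_le_tangent hX) /(_ Xx TM).
by rewrite leqNgt ltnS (leq_trans (rank_leq_row _)).
Qed.

End Dimension.

(** * Polynomial automorphisms and smooth points *)

Section PolyValues.
Variable K : closedFieldType.

Lemma poly_eq_values (p q : {poly K}) : (forall t, p.[t] = q.[t]) -> p = q.
Proof.
move=> pq; apply/eqP; rewrite -subr_eq0; apply/negPn/negP => /closed_nonrootP[t].
by rewrite /root hornerD hornerN pq subrr eqxx.
Qed.

Hypothesis charK : [pchar K] =i pred0.

Lemma size_deriv_pchar0 (p : {poly K}) : size p^`() = (size p).-1.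
Proof.
have [le1|gt1] := leqP (size p) 1.
  by rewrite (size1_polyC le1) derivC size_poly0 size_polyC; case: eqP.
have p0 : p != 0 by apply: contraTneq gt1 => ->; rewrite size_poly0.
apply/eqP; rewrite eqn_leq; apply/andP; split.
  by have := lt_size_deriv p0; case: (size p) gt1.
rewrite leqNgt; apply/negP.
have -> : (size p).-1 = (size p).-2.+1 by case: (size p) gt1 => [|[]].
rewrite ltnS => /leq_sizeP /(_ _ (leqnn _)) /eqP.
rewrite coef_deriv -mulr_natr mulf_eq0 ((pcharf0P K).1 charK) orbF.
have -> : (size p).-2.+1 = (size p).-1 by case: (size p) gt1 => [|[]].
by rewrite -lead_coefE lead_coef_eq0 (negPf p0).
Qed.

End PolyValues.

Section Differential.
Variables (K : closedFieldType) (n : nat).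
Implicit Types (x v : 'rV[K]_n).

(** [dpeval] with the polynomial as last argument, so that it carries an additive structure. *)
Definition dpev x v (p : {mpoly K[n]}) := dpeval p x v.

Lemma dpev_is_additive x v : additive (dpev x v).
Proof.
move=> p q; rewrite /dpev /dpeval -sumrB; apply: eq_bigr => i _.
by rewrite mderivB pevalB mulrBl.
Qed.
HB.instance Definition _ x v := GRing.isAdditive.Build {mpoly K[n]} K (dpev x v)
  (dpev_is_additive x v).

Lemma dpev_leibniz x v : leibniz (evalp x) (dpev x v).
Proof.
move=> p q; rewrite /dpev /dpeval !mulr_sumr -big_split; apply: eq_bigr => i _ /=.
by rewrite mderivM pevalD !pevalM -!evalpE; ring.
Qed.

Lemma dpevC x v c : dpev x v c%:MP = 0.
Proof. by rewrite /dpev /dpeval big1 // => i _; rewrite mderivC peval0 mul0r. Qed.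

Lemma dpevX x v j : dpev x v 'X_j = v 0 j.
Proof.
rewrite /dpev /dpeval (bigD1 j) //= mderivXU eqxx peval1 mul1r.
by rewrite big1 ?addr0 // => i /negPf ij; rewrite mderivXU eq_sym ij peval0 mul0r.
Qed.

Lemma dpev_horner x v (p : {poly K}) (T : {mpoly K[n]}) :
  dpev x v (map_poly (@mpolyC n K) p).[T] = p^`().[peval T x] * dpev x v T.
Proof.
rewrite (leibniz_horner _ _ (@dpev_leibniz x v) (dpevC x v)); congr (_^`().[_] * _).
by apply: map_poly_id => a _ /=; exact: pevalC.
Qed.

End Differential.

Section PolynomialMaps.
Variables (K : closedFieldType).

Definition dmap n m (g : 'I_n -> {mpoly K[m]}) (y w : 'rV[K]_m) : 'rV[K]_n :=
  \row_j dpev y w (g j).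

Lemma dpev_mcomp n m (g : 'I_n -> {mpoly K[m]}) y w p :
  dpev y w (mcomp g p) = dpev (pmap g y) (dmap g y w) p.
Proof.
rewrite /mcomp (@chain_rule _ _ _ _ _ g (evalp y)); first last.
- exact: dpevC.
- exact: dpev_leibniz.
by apply: eq_bigr => i _; rewrite mxE -peval_mcomp.
Qed.

Lemma dmap_mx n m (g : 'I_n -> {mpoly K[m]}) y w :
  dmap g y w = w *m (map_mx (evalp y) (jacmx g))^T.
Proof. by apply/rowP => i; rewrite mxE -dpevalE. Qed.

Lemma tangent_pmap n m (g : 'I_n -> {mpoly K[m]}) S T y w :
  (forall x, S x -> T (pmap g x)) -> tangent_space S y w ->
  tangent_space T (pmap g y) (dmap g y w).
Proof.
move=> gST tw p pT; change (dpev (pmap g y) (dmap g y w) p = 0).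
by rewrite -dpev_mcomp; apply: tw => x Sx; rewrite peval_mcomp; apply/pT/gST.
Qed.

Variable n : nat.
Implicit Types (X : set 'rV[K]_n) (g : 'I_n -> {mpoly K[n]}).

(** The two maps are inverse to each other on [X] only, not on the ambient space. *)
Definition polyaut X g g' := forall x, X x ->
  [/\ X (pmap g x), X (pmap g' x), pmap g' (pmap g x) = x & pmap g (pmap g' x) = x].

Lemma pmap_mcomp g f (x : 'rV[K]_n) : pmap (fun j => mcomp f (g j)) x = pmap g (pmap f x).
Proof. by apply/rowP => j; rewrite !mxE peval_mcomp. Qed.

Lemma polyaut_comp X g g' f f' : polyaut X g g' -> polyaut X f f' ->
  polyaut X (fun j => mcomp f (g j)) (fun j => mcomp g' (f' j)).
Proof.
move=> gP fP x Xx; rewrite !pmap_mcomp.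
have [X1 X2 E1 E2] := fP x Xx; have [X3 X4 E3 E4] := gP x Xx.
have [X5 X6 E5 E6] := gP _ X1; have [X7 X8 E7 E8] := fP _ X4.
by split=> //; rewrite ?E5 ?E8.
Qed.

Lemma polyaut_id X : polyaut X (fun i => 'X_i) (fun i => 'X_i).
Proof.
have id (x : 'rV[K]_n) : pmap (fun i => 'X_i) x = x.
  by apply/rowP => j; rewrite mxE pevalX.
by move=> x Xx; rewrite !id.
Qed.

(** The coordinates of the composite of [g] and [g'] differ from the ambient coordinates by
    equations of [X], which tangent vectors kill. *)
Lemma dmap_polyaut X g g' x w : polyaut X g g' -> X x -> tangent_space X x w ->
  dmap g' (pmap g x) (dmap g x w) = w.
Proof.
move=> gP Xx tw; apply/rowP => j; rewrite mxE -dpev_mcomp.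
apply/eqP; rewrite -subr_eq0 -(dpevX x w j) -raddfB; apply/eqP/tw => y Xy.
rewrite pevalB peval_mcomp pevalX; have [_ _ E _] := gP y Xy.
by have := congr1 (fun z : 'rV_n => z 0 j) E; rewrite mxE => ->; rewrite subrr.
Qed.

End PolynomialMaps.

Section Smooth.
Variables (K : closedFieldType) (charK : [pchar K] =i pred0) (n : nat).
Variables (X : set 'rV[K]_n) (hX : affine_variety X) (d : nat) (hd : krull_dim X d).

Lemma tangent_basis S (x : 'rV[K]_n) : exists e (M : 'M[K]_(e, n)),
  row_free M /\ forall v, tangent_space S x v <-> (v <= M)%MS.
Proof.
have [m [r [_ rT]]] := tangent_equations S x.
exists _, (row_base (kermx (map_mx (evalp x) (jacmx r))^T)).
split; first exact: row_base_free.
by move=> v; rewrite (eq_row_base _); apply: rT.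
Qed.

Lemma smooth_tangent x : smooth_point X x -> exists2 M : 'M[K]_(d, n), row_free M &
  forall v, tangent_space X x v <-> (v <= M)%MS.
Proof.
move=> [_ [e [[F Fc] Fmax] /linear_dimP]].
have [[G Gc] Gmax] := hd.
suff -> : e = d by [].
by apply/eqP; rewrite eqn_leq (Gmax _ _ Fc) (Fmax _ _ Gc).
Qed.

(** An upper bound is enough: [d] independent functions on [X] bound the dimension of the tangent
    space from below. *)
Lemma smooth_of_tangent x e (M : 'M[K]_(e, n)) : X x ->
  (forall v, tangent_space X x v -> (v <= M)%MS) -> (\rank M <= d)%N -> smooth_point X x.
Proof.
move=> Xx TM rM; split=> //; exists d => //; apply/linear_dimP.
have [k [B [Bfree TB]]] := tangent_basis X x.
have [u uX] := krull_indep hd.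
have dk := indep_le_tangent charK hX uX Xx TB.
rewrite (eqP Bfree) in dk.
have kd : (k <= d)%N.
  rewrite -(eqP Bfree) (leq_trans _ rM) // mxrankS //.
  by apply/row_subP => i; apply/TM/TB/row_sub.
have E : k = d by apply/eqP; rewrite eqn_leq kd dk.
by move: B Bfree TB; rewrite E => B Bfree TB; exists B.
Qed.

(** The differential of [g'] maps the tangent space at [pmap g x] onto a space containing the one at
    [x], which thus has dimension at most [d]. *)
Lemma smooth_polyaut g g' x : polyaut X g g' -> X x -> smooth_point X (pmap g x) ->
  smooth_point X x.
Proof.
move=> gP Xx sgx; have [M Mfree TM] := smooth_tangent sgx.
pose J := (map_mx (evalp x) (jacmx g))^T.
pose J' := (map_mx (evalp (pmap g x)) (jacmx g'))^T.
apply: (@smooth_of_tangent _ _ (M *m J')) => //; last first.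
  by rewrite (leq_trans (mxrankM_maxl _ _)) // rank_leq_row.
move=> v tv; rewrite -(dmap_polyaut gP Xx tv) [dmap g' _ _]dmap_mx submxMr //.
by apply/TM; apply: (tangent_pmap _ tv) => y Xy; have [] := gP y Xy.
Qed.

(** [b] is a minor of size [n - d] of the Jacobian matrix of equations of [X]; where it is nonzero,
    the tangent space has dimension at most [d]. *)
Lemma smooth_equation x0 : smooth_point X x0 -> exists b, peval b x0 != 0 /\
  forall x, X x -> peval b x != 0 -> smooth_point X x.
Proof.
move=> s0; have [M Mfree TM] := smooth_tangent s0.
have [m [r [rX rT]]] := tangent_equations X x0.
set G := map_mx (evalp x0) (jacmx r) in rT.
have [f [g fg]] := nonzero_minor G.
have rG : (n - \rank G)%N = d.
  rewrite -mxrank_tr -mxrank_ker -(eqP Mfree).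
  by apply/eqmx_rank/andP; split; apply/rV_subP => w; [move/rT/TM|move/TM/rT].
exists (\det (mxsub f g (jacmx r))); split.
  by rewrite -evalpE -det_map_mx map_mxsub.
move=> x Xx; rewrite -evalpE -det_map_mx map_mxsub => /minor_rank rk.
apply: (@smooth_of_tangent _ _ (kermx (map_mx (evalp x) (jacmx r))^T)) => //.
  move=> v tv; apply/sub_kermxP/rowP => i; rewrite -dpevalE mxE.
  exact: (tv _ (rX i)).
by rewrite mxrank_ker mxrank_tr -rG leq_sub2l.
Qed.

End Smooth.

(** * Polynomial actions of the additive group *)

Section PolynomialActions.
Variables (K : closedFieldType) (n : nat).
Implicit Types (X : set 'rV[K]_n) (x v : 'rV[K]_n) (f h : {mpoly K[n]}).
Implicit Types (P : 'I_n -> {poly {mpoly K[n]}}).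

(* A family of polynomial maps of the affine space, with time the variable of
   the outer polynomial ring. *)
Definition pact P (t : K) x : 'rV[K]_n := \row_j (map_poly (evalp x) (P j)).[t].

Definition is_pact X P := forall x, X x ->
  [/\ forall t, X (pact P t x), pact P 0 x = x &
      forall s t, pact P (s + t) x = pact P s (pact P t x)].

Definition velocity P x : 'rV[K]_n := \row_j peval (P j)`_1 x.

Definition follow P : {mpoly K[n]} -> {poly {mpoly K[n]}} :=
  mmap (polyC \o @mpolyC n K) P.

Definition line P f x : {poly K} := map_poly (evalp x) (follow P f).

Lemma lineE P f x : line P f x = mmap polyC (fun j => map_poly (evalp x) (P j)) f.
Proof.
rewrite /line /follow rmorph_mmap; apply: eq_mmap => c //=.
by rewrite map_polyC /= evalpE pevalC.
Qed.

Lemma line_eval P f x t : (line P f x).[t] = peval f (pact P t x).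
Proof.
rewrite lineE -[_.[t]]/(horner_eval t _) rmorph_mmap; apply: eq_mmap => [c|j] /=.
  by rewrite /horner_eval hornerC.
by rewrite mxE.
Qed.

Lemma lineX P j x : line P 'X_j x = map_poly (evalp x) (P j).
Proof. by rewrite lineE mmapX mmap1U. Qed.

(** For an action [P] on [X] this is, modulo [vanish X], the locally nilpotent derivation attached
    to [P]. *)
Definition lder P f : {mpoly K[n]} := (follow P f)`_1.

Lemma peval_lder P f x : peval (lder P f) x = (line P f x)`_1.
Proof. by rewrite coef_map. Qed.

Lemma peval_lder_dpev P f x : pact P 0 x = x ->
  peval (lder P f) x = dpev x (velocity P x) f.
Proof.
move=> P0; rewrite peval_lder lineE.
have lc1 : leibniz (coefp 0) (coefp 1 : {poly K} -> K).
  move=> p q; rewrite /= coefM !big_ord_recl big_ord0 addr0 /=.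
  by congr (_ + _); exact: mulrC.
rewrite -[LHS]/(coefp 1 _) (@chain_rule _ _ _ _ _ _ (coefp 0) (coefp 1) lc1) => [|c].
  apply: eq_bigr => j _; rewrite mxE -lineE /= -horner_coef0 line_eval P0.
  by rewrite coef_map.
by rewrite /= coefC.
Qed.

Lemma velocity_tangent X P x : is_pact X P -> X x ->
  tangent_space (Defs.orbit (pact P) x) x (velocity P x).
Proof.
move=> PX Xx p pO; change (dpev x (velocity P x) p = 0).
have [_ P0 _] := PX x Xx.
rewrite -peval_lder_dpev // peval_lder (_ : line P p x = 0) ?coef0 //.
by apply: poly_eq_values => t; rewrite line_eval horner0 pO //; exists t.
Qed.

Lemma velocity_tangent_variety X P x : is_pact X P -> X x ->
  tangent_space X x (velocity P x).
Proof.
move=> PX Xx p pX; apply: (velocity_tangent PX Xx) => y [t _ <-].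
by apply: pX; have [] := PX x Xx.
Qed.

Lemma line_shift X P f x t : is_pact X P -> X x ->
  line P f (pact P t x) = line P f x \Po ('X + t%:P).
Proof.
move=> PX Xx; apply: poly_eq_values => s.
have [_ _ PD] := PX x Xx.
by rewrite line_eval -PD horner_comp hornerD hornerX hornerC line_eval.
Qed.

Lemma line_lder X P f x : is_pact X P -> X x -> line P (lder P f) x = (line P f x)^`().
Proof.
move=> PX Xx; apply: poly_eq_values => t.
rewrite line_eval peval_lder (line_shift _ _ PX Xx).
have c1 (p : {poly K}) : p`_1 = p^`().[0] by rewrite horner_coef0 coef_deriv mulr1n.
rewrite c1 deriv_comp hornerM horner_comp derivD derivX derivC addr0 hornerC mulr1.
by rewrite hornerD hornerX hornerC add0r.
Qed.

Lemma line_iter_lder X P f x k : is_pact X P -> X x ->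
  line P (iter k (lder P) f) x = (line P f x)^`(k).
Proof.
move=> PX Xx; elim: k => [|k IH]; first by rewrite derivn0.
by rewrite iterS (line_lder _ PX) // IH derivnS.
Qed.

Lemma line_vanish X P f x : is_pact X P -> X x -> vanish X f -> line P f x = 0.
Proof.
move=> PX Xx fX; apply: poly_eq_values => t; rewrite line_eval horner0.
by apply: fX; have [] := PX x Xx.
Qed.

Definition flow P t : 'I_n -> {mpoly K[n]} := fun j => (P j).[t%:MP_[n]].

Lemma pmap_flow P t x : pmap (flow P t) x = pact P t x.
Proof.
apply/rowP => j; rewrite !mxE -evalpE -horner_map /=.
by congr (_.[_]); exact: pevalC.
Qed.

Lemma flow_polyaut X P t : is_pact X P -> polyaut X (flow P t) (flow P (- t)).
Proof.
move=> PX x Xx; rewrite !pmap_flow; have [PXx P0 PD] := PX x Xx.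
by split=> //; rewrite -PD ?addNr ?subrr.
Qed.

Definition conj_pact g g' P : 'I_n -> {poly {mpoly K[n]}} :=
  fun j => mmap (polyC \o @mpolyC n K) (fun k => map_poly (mcomp g) (P k)) (g' j).

Lemma conj_pactE g g' P t x :
  pact (conj_pact g g' P) t x = pmap g' (pact P t (pmap g x)).
Proof.
apply/rowP => j; rewrite !mxE.
rewrite -[LHS]/((horner_eval t \o map_poly (evalp x)) _) rmorph_mmap.
apply: eq_mmap => [c|k] /=.
  by rewrite map_polyC /= /horner_eval hornerC; exact: pevalC.
rewrite mxE /horner_eval -map_poly_comp; congr (_.[_]).
by apply: eq_map_poly => p /=; rewrite !evalpE peval_mcomp.
Qed.

Lemma conj_is_pact X g g' P : polyaut X g g' -> is_pact X P -> is_pact X (conj_pact g g' P).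
Proof.
move=> gP PX x Xx; have [Xg _ E _] := gP x Xx; have [XP P0 PD] := PX _ Xg.
split=> [t||s t]; rewrite !conj_pactE.
- by have [] := gP _ (XP t).
- by rewrite P0.
by have [_ _ _ ->] := gP _ (XP t); rewrite PD.
Qed.

Lemma conj_velocity X g g' P x : polyaut X g g' -> is_pact X P -> X x ->
  dmap g x (velocity (conj_pact g g' P) x) = velocity P (pmap g x).
Proof.
move=> gP PX Xx; have CX := conj_is_pact gP PX.
have [Xg _ E _] := gP x Xx; have [XP P0 PD] := PX _ Xg; have [_ C0 _] := CX x Xx.
apply/rowP => j; rewrite mxE -(peval_lder_dpev _ C0) peval_lder [RHS]mxE.
rewrite (_ : line _ _ _ = map_poly (evalp (pmap g x)) (P j)) ?coef_map //.
apply: poly_eq_values => t; rewrite line_eval conj_pactE.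
have [_ _ _ H] := gP _ (XP t).
have := congr1 (fun z : 'rV_n => z 0 j) H; rewrite !mxE => <-.
by [].
Qed.

Lemma effective_conj X g g' P : polyaut X g g' -> is_pact X P ->
  effective X (pact P) -> effective X (pact (conj_pact g g' P)).
Proof.
move=> gP PX eP t Ht; apply: eP => x Xx.
have [_ Xg _ E] := gP x Xx; have := Ht _ Xg; rewrite conj_pactE E => E1.
have [XP _ _] := PX x Xx.
by have [_ _ _ <-] := gP _ (XP t); rewrite E1 E.
Qed.

Lemma pact_Ga_action X P : is_pact X P -> Ga_action X (pact P).
Proof.
move=> PX; split=> [|x Xx|s t x Xx]; last 2 first.
- by have [] := PX x Xx.
- by have [_ _] := PX x Xx; apply.
split=> [y Xy|j]; first by have [+ _ _] := PX _ Xy; apply.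
set U := affine_times 1 X.
have H : regular_on U (fun y => (map_poly (evalp (rsubmx y)) (P j)).[lsubmx y 0 0]).
  apply: regular_horner => [k|].
    by apply: (regular_ext (@regular_coord _ _ U (rshift 1 k))) => y _; rewrite mxE.
  by apply: (regular_ext (@regular_coord _ _ U (lshift n 0))) => y _; rewrite mxE.
by apply: (regular_ext H) => y _; rewrite [RHS]mxE.
Qed.

Lemma time_poly (p : {mpoly K[1 + n]}) : exists Q : {poly {mpoly K[n]}},
  forall t x, (map_poly (evalp x) Q).[t] = peval p (row_mx (const_mx t) x).
Proof.
exists (mmap (polyC \o @mpolyC n K)
  (fun i => match split i with inl _ => 'X | inr k => ('X_k)%:P end) p) => t x.
rewrite -[LHS]/((horner_eval t \o map_poly (evalp x)) _) rmorph_mmap.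
apply: eq_mmap => [c|i] /=.
  by rewrite map_polyC /= /horner_eval hornerC; exact: pevalC.
rewrite mxE; case: (split i) => k; rewrite /horner_eval.
  by rewrite map_polyX hornerX mxE.
by rewrite map_polyC hornerC /= evalpE pevalX.
Qed.

Lemma affine_times_closed X m : zariski_closed X -> zariski_closed (affine_times m X).
Proof.
move=> /zero_locus_vanish XE.
exists [set mcomp (fun j => 'X_(rshift m j)) p | p in vanish X].
have subE (y : 'rV[K]_(m + n)) : pmap (fun j => 'X_(rshift m j)) y = rsubmx y.
  by apply/rowP => j; rewrite !mxE pevalX.
apply/seteqP; split=> [y Xy _ [p pX <-]|y Hy].
  by rewrite peval_mcomp subE; apply: pX.
rewrite /affine_times /= -XE => p pX; rewrite -subE -peval_mcomp.
by apply: Hy; exists p.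
Qed.

(** A regular function on a closed set is the restriction of a polynomial, by
    [regular_principal_open] with [h = 1]; this applies to the coordinates of the action map on the
    line times [X]. *)
Lemma Ga_action_pact X a : affine_variety X -> Ga_action X a ->
  exists P, is_pact X P /\ forall x, X x -> forall t, pact P t x = a t x.
Proof.
move=> [clX _] [[aX areg] a0 aD].
have rowX t x : X x -> affine_times 1 X (row_mx (const_mx t) x).
  by rewrite /affine_times /= row_mxKr.
have Pj j : exists Q : {poly {mpoly K[n]}}, forall x, X x -> forall t,
    (map_poly (evalp x) Q).[t] = a t x 0 j.
  have [|p [N pE]] := @regular_principal_open K _ (affine_times 1 X) 1
     (fun y => a (lsubmx y 0 0) (rsubmx y) 0 j) (affine_times_closed 1 clX).
    apply/regular_onP => y [Xy _]; have /regular_onP/(_ y Xy)[p [q [qy Hpq]]] := areg j.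
    by exists p, q; split=> // z [Xz _]; apply: Hpq.
  have [Q QE] := time_poly p; exists Q => x Xx t; rewrite QE.
  have := pE _ (rowX t x Xx); rewrite peval1 oner_eq0 expr1n divr1 => <- //.
  by rewrite row_mxKl row_mxKr mxE.
have [P PE] := choice Pj; exists P.
have PaE x : X x -> forall t, pact P t x = a t x.
  by move=> Xx t; apply/rowP => j; rewrite mxE PE.
have aXt x t : X x -> X (a t x).
  by move=> Xx; have := aX _ (rowX t x Xx); rewrite row_mxKl row_mxKr mxE.
split=> // x Xx; split=> [t||s t]; rewrite ?PaE //; [exact: aXt|exact: a0|exact: aD|].
exact: aXt.
Qed.

End PolynomialActions.

(** * Local slices of actions *)

Section Slices.
Variables (K : closedFieldType) (charK : [pchar K] =i pred0) (n : nat).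
Implicit Types (X : set 'rV[K]_n) (x v : 'rV[K]_n) (f h : {mpoly K[n]}).
Implicit Types (P : 'I_n -> {poly {mpoly K[n]}}).

Lemma tangent_dpev X x v p : tangent_space X x v -> vanish X p -> dpev x v p = 0.
Proof. by apply. Qed.

(** Replacing [f] by [lder P f] lowers its degree along the orbit by exactly one, so degree one is
    reached. *)
Lemma affine_line P X f x : is_pact X P -> X x -> (1 < size (line P f x))%N ->
  exists f', size (line P f' x) = 2.
Proof.
move=> PX Xx; have [N] := ubnP (size (line P f x)).
elim: N f => // N IH f sN s1; have [s2|s2] := eqVneq (size (line P f x)) 2.
  by exists f.
apply: (IH (lder P f)); rewrite (line_lder _ PX) // size_deriv_pchar0 //.
  by move: sN s1; rewrite ltnS; case: (size _).
by move: s1 s2; case: (size _) => [|[|[|]]].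
Qed.

(* The coordinate ring of a nontrivial orbit contains the time coordinate [T], so
   the orbit is the graph of [x = P (T, x)]. *)
Lemma orbit_tangent P X x v : is_pact X P -> X x ->
  tangent_space (Defs.orbit (pact P) x) x v -> exists c, v = c *: velocity P x.
Proof.
move=> PX Xx tv; have [XP P0 PD] := PX x Xx.
(* If all coordinates are constant along the orbit, it is a single point and [v] is zero. *)
case: (pselect (exists j, (1 < size (map_poly (evalp x) (P j)))%N)); last first.
  move=> no; exists 0; rewrite scale0r; apply/rowP => j; rewrite mxE.
  have /size1_polyC cj : (size (map_poly (evalp x) (P j)) <= 1)%N.
    by rewrite leqNgt; apply/negP => H; apply: no; exists j.
  suff : dpev x v ('X_j - ((map_poly (evalp x) (P j))`_0)%:MP) = 0.
    by rewrite raddfB /= dpevX dpevC subr0.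
  apply: (tangent_dpev tv) => y [t _ <-].
  by rewrite pevalB pevalX pevalC mxE cj coefC hornerC subrr.
move=> [j0]; rewrite -lineX => /(affine_line PX Xx)[f sf].
pose al := (line P f x)`_0; pose be := (line P f x)`_1.
have beE : be = lead_coef (line P f x) by rewrite lead_coefE sf.
have be0 : be != 0 by rewrite beE lead_coef_eq0 -size_poly_eq0 sf.
have ft t : peval f (pact P t x) = al + be * t.
  by rewrite -line_eval horner_coef sf !big_ord_recl big_ord0 addr0 expr0 mulr1 expr1.
(* Along the orbit [f] is affine in time with nonzero slope; normalized, it becomes the time
   itself. *)
pose T := (be^-1)%:MP * (f - al%:MP).
have Tt t : peval T (pact P t x) = t.
  by rewrite pevalM pevalB !pevalC ft addrC addKr mulKf.
have T0 : peval T x = 0 by rewrite -[in LHS]P0 Tt.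
exists (dpev x v T); apply/rowP => j; rewrite !mxE.
pose c := map_poly (evalp x) (P j).
have : dpev x v ('X_j - (map_poly (@mpolyC n K) c).[T]) = 0.
  apply: (tangent_dpev tv) => y [t _ <-]; rewrite pevalB pevalX mxE -/c -evalpE -horner_map -map_poly_comp /=.
  rewrite evalpE Tt map_poly_id ?subrr // => a _ /=; exact: pevalC.
rewrite raddfB /= dpevX dpev_horner T0 => /eqP; rewrite subr_eq0 => /eqP ->.
by rewrite mulrC horner_coef0 coef_deriv mulr1n coef_map.
Qed.

(** A local slice of the action, in the language of locally nilpotent derivations. *)
Definition is_slice X P f h := forall x, X x -> forall t,
  peval f (pact P t x) = peval f x + t * peval h x.

(** Compare [f] at time [1 + t] reached in one step and in two. *)
Lemma slice_invariant X P f h x t : is_pact X P -> is_slice X P f h -> X x ->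
  peval h (pact P t x) = peval h x.
Proof.
move=> PX fP Xx; have [XP _ PD] := PX x Xx.
have E := fP x Xx (1 + t); rewrite PD fP // (fP x) // in E.
by apply: (@addrI _ (peval f x + t * peval h x)); rewrite -[X in _ + X = _]mul1r E; ring.
Qed.

Lemma conj_slice X g g' P f h : polyaut X g g' -> is_pact X P -> is_slice X P f h ->
  is_slice X (conj_pact g g' P) (mcomp g f) (mcomp g h).
Proof.
move=> gP PX fP x Xx t; have [Xg _ _ _] := gP x Xx; have [XP _ _] := PX _ Xg.
by rewrite !peval_mcomp conj_pactE; have [_ _ _ ->] := gP _ (XP t); rewrite fP.
Qed.

(* Iterating the derivation of a polynomial action eventually kills [b]; the last
   nonzero iterate is annihilated by it. *)
Lemma last_iterate X P b : is_pact X P -> ~ vanish X b ->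
  exists k, ~ vanish X (iter k (lder P) b) /\ vanish X (lder P (iter k (lder P) b)).
Proof.
move=> PX bX.
pose Q k := `[< vanish X (iter k (lder P) b) >].
have exQ : exists k, Q k.
  exists (size (follow P b)); apply/asboolP => x Xx; have [_ P0 _] := PX x Xx.
  rewrite -[in LHS]P0 -line_eval (line_iter_lder _ _ PX) //.
  suff -> : (line P b x)^`(size (follow P b)) = 0 by rewrite horner0.
  apply/polyP => i; rewrite coef_derivn coef0 nth_default ?mul0rn //.
  by rewrite (leq_trans (size_poly _ _)) // leq_addr.
case: (ex_minnP exQ) => -[|k] /asboolP kX mink; first by [].
by exists k; split=> // k'X; have := mink k; rewrite ltnn => /(_ (asboolT k'X)).
Qed.

(** Some coordinate has a nonzero derivative. [f] is the last of its iterated derivatives whose own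
    derivative is nonzero on [X], so it has degree at most one in time. *)
Lemma slice_exists X P : affine_variety X -> is_pact X P ->
  (exists t x, X x /\ pact P t x <> x) ->
  exists f h, is_slice X P f h /\ ~ vanish X h.
Proof.
move=> hX PX [t [x [Xx Ptx]]]; have [XP P0 _] := PX x Xx.
have [j j1] : exists j, ~ vanish X (lder P 'X_j).
  apply: contrapT => /forallNP no; apply/Ptx/rowP => j.
  have /contrapT /(line_vanish PX Xx) := no j.
  rewrite (line_lder _ PX) // => d0.
  rewrite -(pevalX j (pact _ _ _)) -line_eval -{2}P0 -(pevalX j (pact _ _ _)) -line_eval.
  have /size1_polyC -> : (size (line P 'X_j x) <= 1)%N.
    by have := size_deriv_pchar0 charK (line P 'X_j x); rewrite d0 size_poly0; case: (size _) => [|[]].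
  by rewrite !hornerC.
have [k [kX kX']] := last_iterate PX j1.
pose f := iter k (lder P) 'X_j.
have fE : iter k (lder P) (lder P 'X_j) = lder P f := esym (iterSr k (lder P) 'X_j).
rewrite fE in kX kX'; exists f, (lder P f); split; last exact: kX.
move=> y Xy s; have [_ Q0 _] := PX y Xy.
have := line_vanish PX Xy kX'; rewrite !(line_lder _ PX Xy).
move=> /(congr1 (fun q : {poly K} => size q)); rewrite size_poly0 !(size_deriv_pchar0 charK) => s2.
rewrite -line_eval peval_lder -[X in _ = peval f X + _]Q0 -line_eval horner_coef0.
rewrite (@horner_coef_wide _ 2); last by case: (size _) s2 => [|[|[]]].
by rewrite !big_ord_recl big_ord0 addr0 mulr1 expr1 mulrC.
Qed.

(** The slice is multiplied by an invariant [b'], the last nonzero iterated derivative of the [b] of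
    [smooth_equation]. The orbit of a singular point is singular, so [b] vanishes along it, and
    hence so does [b']. *)
Lemma smooth_slice_exists X d P x0 : affine_variety X -> krull_dim X d ->
  smooth_point X x0 -> is_pact X P -> (exists t x, X x /\ pact P t x <> x) ->
  exists f h, [/\ is_slice X P f h, ~ vanish X h &
    forall x, X x -> peval h x != 0 -> smooth_point X x].
Proof.
move=> hX hd s0 PX ntP; have [f [h [fP hX0]]] := slice_exists hX PX ntP.
have [b [bx0 bs]] := smooth_equation charK hX hd s0.
have bX : ~ vanish X b by apply/not_vanish; exists x0 => //; case: s0.
have [k [kX kX']] := last_iterate PX bX; set b' := iter k _ _ in kX kX'.
have b'P x t : X x -> peval b' (pact P t x) = peval b' x.
  move=> Xx; have [_ P0 _] := PX x Xx; rewrite -{2}P0 -!line_eval.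
  have := line_vanish PX Xx kX'; rewrite (line_lder _ PX) // => d0.
  have /size1_polyC -> : (size (line P b' x) <= 1)%N.
    by have := size_deriv_pchar0 charK (line P b' x); rewrite d0 size_poly0; case: (size _) => [|[]].
  by rewrite !hornerC.
exists (f * b'), (h * b'); split.
- by move=> x Xx t; rewrite !pevalM fP // b'P //; ring.
- by have [_ _ pr] := affine_variety_prime hX; move=> /pr[].
move=> x Xx; rewrite pevalM mulf_eq0 negb_or => /andP[_ b'x].
apply: contrapT => ns; move/negP: b'x; apply; apply/eqP.
have [XP P0 PD] := PX x Xx.
have lb0 : line P b x = 0.
  apply: poly_eq_values => t; rewrite line_eval horner0; apply/eqP/negPn/negP => bt.
  apply/ns/(smooth_polyaut charK hX hd (flow_polyaut t PX) Xx); rewrite pmap_flow.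
  exact: bs.
by rewrite -[in LHS]P0 -line_eval (line_iter_lder _ _ PX) // lb0 linear0 horner0.
Qed.

End Slices.

(** * Cylinders from slices *)

Section SliceCylinder.
Variables (K : closedFieldType) (n : nat) (X : set 'rV[K]_n) (hX : affine_variety X).
Variables (P : 'I_n -> {poly {mpoly K[n]}}) (PX : is_pact X P).
Variables (f h : {mpoly K[n]}) (fP : is_slice X P f h) (hN : ~ vanish X h).
Hypothesis smooth_h : forall x, X x -> peval h x != 0 -> smooth_point X x.

Let U : set 'rV[K]_n := [set x | X x /\ peval h x != 0].

(* The base is the section [f = 0] of the action inside [D(h)]; the last
   coordinate is the inverse of [h]. *)
Let Z : set 'rV[K]_(n + 1) := [set z : 'rV[K]_(n + 1) | [/\ X (lsubmx z),
  peval f (lsubmx z) = 0 & peval h (lsubmx z) * rsubmx z 0 0 = 1]].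

(** The time at which the flow from the section reaches [x]; [base] flows back by it. *)
Let time (x : 'rV[K]_n) := peval f x / peval h x.
Let base (x : 'rV[K]_n) : 'rV[K]_(n + 1) :=
  row_mx (pact P (- time x) x) (const_mx (peval h x)^-1).
Let phi (x : 'rV[K]_n) : 'rV[K]_(1 + (n + 1)) := row_mx (const_mx (time x)) (base x).
Let psi (y : 'rV[K]_(1 + (n + 1))) : 'rV[K]_n :=
  pact P (lsubmx y 0 0) (lsubmx (rsubmx y)).

Let XP x t : X x -> X (pact P t x).
Proof. by move=> Xx; have [] := PX Xx. Qed.

Let base_Z x : U x -> Z (base x).
Proof.
move=> [Xx hx]; rewrite /Z /= row_mxKl row_mxKr mxE; split; first exact: XP.
  by rewrite fP // /time mulNr divfK // subrr.
by rewrite (slice_invariant _ PX fP) // divff.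
Qed.

Let time_flow x t : U x -> time (pact P t x) = time x + t.
Proof.
by move=> [Xx hx]; rewrite /time fP // (slice_invariant _ PX fP) // mulrDl mulfK.
Qed.

Let base_flow x t : U x -> base (pact P t x) = base x.
Proof.
move=> Ux; have [Xx hx] := Ux; have [_ _ PD] := PX Xx.
rewrite /base time_flow // (slice_invariant _ PX fP) // -PD.
by congr (row_mx (pact P _ _) _); ring.
Qed.

Let time_regular : regular_on U time.
Proof.
apply: regularM; first exact: regular_peval.
by apply: regularV => [|x []//]; apply: regular_peval.
Qed.

Let base_regular j : regular_on U (fun x => base x 0 j).
Proof.
case: (split_ordP j) => k ->.
  have H : regular_on U (fun x => (map_poly (evalp x) (P k)).[-1 * time x]).
    apply: (@regular_horner _ _ _ U id) => [i|]; first exact: regular_coord.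
    by apply: regularM => //; apply: regular_cst.
  by apply: (regular_ext H) => x _; rewrite row_mxEl mxE mulN1r.
have H : regular_on U (fun x => (peval h x)^-1).
  by apply: regularV => [|x []//]; apply: regular_peval.
by apply: (regular_ext H) => x _; rewrite row_mxEr mxE.
Qed.

Let Z_closed : zariski_closed Z.
Proof.
pose L := mcomp (fun j => 'X_(lshift 1 j) : {mpoly K[n + 1]}).
have LE p z : peval (L p) z = peval p (lsubmx z).
  rewrite peval_mcomp; congr peval; apply/rowP => j; by rewrite !mxE pevalX.
exists [set q | (exists2 p, vanish X p & q = L p) \/ q = L f \/ q = L h * 'X_(rshift n 0) - 1].
apply/seteqP; split=> [z [Xz fz hz] q [[p pX ->]|[->|->]]|z Hz].
- by rewrite LE; apply: pX.
- by rewrite LE.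
- by rewrite pevalB pevalM LE pevalX peval1; move: hz; rewrite mxE => ->; rewrite subrr.
split.
- rewrite -(zero_locus_vanish hX.1) => p pX; rewrite -LE; apply: Hz; left.
  by exists p.
- by rewrite -LE; apply: Hz; right; left.
have := Hz _ (or_intror (or_intror erefl)).
by rewrite pevalB pevalM LE pevalX peval1 mxE => /eqP; rewrite subr_eq0 => /eqP.
Qed.

Let section_point z : Z z -> U (lsubmx z) /\ base (lsubmx z) = z.
Proof.
move=> [Xz fz hz].
have hz0 : peval h (lsubmx z) != 0.
  by apply: contra_eq_neq hz => ->; rewrite mul0r eq_sym oner_neq0.
split=> //; rewrite /base /time fz mul0r oppr0.
have [_ -> _] := PX Xz; rewrite -[RHS]hsubmxK; congr row_mx.
apply/rowP => j; rewrite ord1 [LHS]mxE; apply: (mulfI hz0).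
by rewrite hz divff.
Qed.

(** [base] maps [U] onto [Z], and functions on [Z] pull back to fractions over powers of [h], so the
    primeness of [vanish X] carries over. *)
Let Z_variety : affine_variety Z.
Proof.
have [x0 Xx0 hx0] := (not_vanish _ _).1 hN.
apply: prime_affine_variety => //; first by exists (base x0); apply: base_Z.
move=> p q pq.
have pull (r : {mpoly K[n + 1]}) : exists r1 N, forall x, X x -> peval h x != 0 ->
    peval r (base x) = peval r1 x / peval h x ^+ N.
  apply: (regular_principal_open hX.1).
  exact: (regular_peval_comp r base_regular).
have [p1 [N pE]] := pull p; have [q1 [M qE]] := pull q.
have hN0 x k : peval h x != 0 -> (peval h x ^+ k)^-1 != 0.
  by move=> hx; rewrite invr_eq0 expf_neq0.
have [_ _ pr] := affine_variety_prime hX.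
have conv r r1 k : (forall x, X x -> peval h x != 0 ->
    peval r (base x) = peval r1 x / peval h x ^+ k) -> vanish X r1 -> vanish Z r.
  move=> rE r1X z Zz; have [[Xz hz] <-] := section_point Zz.
  by rewrite rE // r1X // mul0r.
case: (pr p1 q1) => [|/(conv _ _ _ pE)|/(conv _ _ _ qE)]; [|by left|by right].
apply: (vanish_open hX hN) => x Xx hx.
have := pq _ (base_Z (conj Xx hx)); rewrite !pevalM pE // qE // mulf_div => /eqP.
rewrite mulf_eq0 invr_eq0 [X in _ || X]mulf_eq0 !expf_eq0 (negPf hx) !andbF !orbF.
by move/eqP.
Qed.

Let phi_isomorphism : isomorphism U (affine_times 1 Z) phi.
Proof.
split.
  split=> [x Ux|j]; first by rewrite /affine_times /= row_mxKr; apply: base_Z.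
  case: (split_ordP j) => k ->.
    by apply: (regular_ext time_regular) => x _; rewrite row_mxEl mxE.
  by apply: (regular_ext (base_regular k)) => x _; rewrite row_mxEr.
exists psi; split.
- split=> [y Zy|j].
    have [[Xz hz] _] := section_point Zy.
    by split; [exact: XP|rewrite (slice_invariant _ PX fP)].
  set W := affine_times 1 Z.
  have H : regular_on W (fun y => (map_poly (evalp (lsubmx (rsubmx y))) (P j)).[lsubmx y 0 0]).
    apply: regular_horner => [k|].
      apply: (regular_ext (@regular_coord _ _ W (rshift 1 (lshift 1 k)))) => y _.
      by rewrite !mxE.
    by apply: (regular_ext (@regular_coord _ _ W (lshift (n + 1) 0))) => y _; rewrite !mxE.
  by apply: (regular_ext H) => y _; rewrite [RHS]mxE.
- move=> x [Xx hx]; rewrite /psi row_mxKl !row_mxKr row_mxKl mxE.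
  by have [_ P0 PD] := PX Xx; rewrite -PD subrr.
move=> y Zy; have [Uz bz] := section_point Zy.
rewrite /phi /psi time_flow // base_flow // bz -[RHS]hsubmxK; congr row_mx.
have [_ fz _] := Zy.
by apply/rowP => j; rewrite ord1 [LHS]mxE /time fz mul0r add0r.
Qed.

Let U_open : open_in (smooth_locus X) U.
Proof.
exists (zero_locus [set h]); first exact: zero_locus_closed.
apply/seteqP; split=> [x [Xx hx]|x [[Xx _] nh]]; split=> //.
- exact: smooth_h.
- by move/(_ h erefl) => h0; rewrite h0 eqxx in hx.
by apply/eqP => h0; apply: nh => _ ->.
Qed.

Lemma slice_cylinder : exists C : cylinder (smooth_locus X),
  [/\ (C : set 'rV[K]_n) = [set x | X x /\ peval h x != 0], principal X C &
      forall x t, X x -> peval h x != 0 -> cyl_proj C (pact P t x) = cyl_proj C x].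
Proof.
exists (Cylinder U_open (ltn0Sn 0) Z_variety phi_isomorphism); split=> //.
  by exists (peval h) => //; apply: regular_peval.
by move=> x t Xx hx; rewrite /cyl_proj /= !row_mxKr base_flow.
Qed.

End SliceCylinder.

(** * Families of points in an orbit *)

Section Families.
Variables (K : closedFieldType) (n : nat).
Implicit Types (X : set 'rV[K]_n) (P : 'I_n -> {poly {mpoly K[n]}}).

Definition row_tail s (t : 'rV[K]_(s.+1)) : 'rV[K]_s := \row_i t 0 (lift ord0 i).

Definition row_cons s (c : K) (t : 'rV[K]_s) : 'rV[K]_(s.+1) :=
  \row_i (if unlift ord0 i is Some j then t 0 j else c).

Lemma row_consK s c (t : 'rV[K]_s) : row_tail (row_cons c t) = t.
Proof. by apply/rowP => i; rewrite !mxE liftK. Qed.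

Definition mshift s : {mpoly K[s]} -> {mpoly K[s.+1]} := mcomp (fun i => 'X_(lift ord0 i)).
HB.instance Definition _ s := GRing.RMorphism.copy (@mshift s)
  (mcomp (fun i => 'X_(lift ord0 i) : {mpoly K[s.+1]})).

Lemma peval_mshift s (p : {mpoly K[s]}) t : peval (mshift p) t = peval p (row_tail t).
Proof.
by rewrite peval_mcomp; congr peval; apply/rowP => i; rewrite !mxE pevalX.
Qed.

Lemma mcomp_mshift s (sg : 'I_s.+1 -> {mpoly K[s]}) q :
  (forall i, sg (lift ord0 i) = 'X_i) -> mcomp sg (mshift q) = q.
Proof.
move=> sgX; rewrite /mshift [in mcomp _ q]/mcomp rmorph_mmap [RHS](rmorph_mpolyE idfun).
apply: eq_mmap => [c|i] /=; first by rewrite mcompC.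
by rewrite mcompX sgX.
Qed.

Section ExtendFamily.
Variables (s : nat) (Phi : 'I_n -> {mpoly K[s]}) (P : 'I_n -> {poly {mpoly K[n]}}).

(** The flow of [P] is applied after the family, and the variable [ord0] is its time. *)
Definition extend_family : 'I_n -> {mpoly K[s.+1]} :=
  fun j => (map_poly (mshift (s:=s) \o mcomp Phi) (P j)).['X_ord0].

Lemma pmap_extend t :
  pmap extend_family t = pact P (t 0 ord0) (pmap Phi (row_tail t)).
Proof.
apply/rowP => j; rewrite !mxE -evalpE -horner_map -map_poly_comp /=.
congr (_.[_]); last exact: pevalX.
by apply: eq_map_poly => p /=; rewrite evalpE peval_mshift peval_mcomp.
Qed.

Lemma dmap_extend_old t i : dmap extend_family t (delta_mx 0 (lift ord0 i)) =
  dmap (flow P (t 0 ord0)) (pmap Phi (row_tail t)) (dmap Phi (row_tail t) (delta_mx 0 i)).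
Proof.
(* [sg] freezes the new time at its value in [t], which turns the extended family into [Phi]
   followed by one flow. *)
pose sg (k : 'I_s.+1) : {mpoly K[s]} :=
  if unlift ord0 k is Some j then 'X_j else (t 0 ord0)%:MP.
have sgE : pmap sg (row_tail t) = t.
  apply/rowP => k; rewrite !mxE /sg; case: unliftP => [j|] ->.
    by rewrite pevalX mxE.
  by rewrite pevalC.
have dsg : dmap sg (row_tail t) (delta_mx 0 i) = delta_mx 0 (lift ord0 i).
  apply/rowP => k; rewrite !mxE /sg eqxx /=; case: unliftP => [j|] ->.
    by rewrite dpevX !mxE eqxx /= (inj_eq lift_inj).
  by rewrite dpevC.
have sgext j : mcomp sg (extend_family j) = mcomp Phi (flow P (t 0 ord0) j).
  rewrite -horner_map -[in RHS]horner_map -!map_poly_comp /= mcompX mcompC.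
  rewrite /sg unlift_none; congr (_.[_]); apply: eq_map_poly => p /=.
  by rewrite mcomp_mshift // => k; rewrite liftK.
apply/rowP => j; rewrite [LHS]mxE -{1}sgE -dsg -dpev_mcomp sgext dpev_mcomp.
by rewrite [RHS]mxE.
Qed.

(** With the old times fixed, the point moves along an orbit; by the group law its derivative at any
    time is the velocity at the point reached. *)
Lemma dmap_extend_new X t : is_pact X P -> X (pmap Phi (row_tail t)) ->
  dmap extend_family t (delta_mx 0 ord0) = velocity P (pmap extend_family t).
Proof.
move=> PX Xz; set z := pmap Phi _ in Xz.
apply/rowP => j; rewrite !mxE pmap_extend -/z.
rewrite (leibniz_horner _ _ (@dpev_leibniz _ _ t (delta_mx 0 ord0))) => [|p].
  rewrite /= dpevX mxE eqxx mulr1.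
  have -> : peval (P j)`_1 (pact P (t 0 ord0) z) = (line P 'X_j (pact P (t 0 ord0) z))`_1.
    by rewrite lineX coef_map.
  rewrite (line_shift _ _ PX Xz) lineX.
  set c := map_poly (evalp z) (P j).
  have -> : (c \Po ('X + (t 0 ord0)%:P))`_1 = (c \Po ('X + (t 0 ord0)%:P))^`().[0].
    by rewrite horner_coef0 coef_deriv mulr1n.
  rewrite deriv_comp hornerM horner_comp derivD derivX derivC addr0 hornerC mulr1.
  rewrite hornerD hornerX hornerC add0r; congr (_^`().[_]); last exact: pevalX.
  by apply: eq_map_poly => p /=; rewrite !evalpE peval_mshift peval_mcomp.
rewrite /= /mshift dpev_mcomp.
rewrite (_ : dmap _ _ _ = 0).
  by rewrite /dpev /dpeval big1 // => i _; rewrite mxE mulr0.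
by apply/rowP => i; rewrite [LHS]mxE dpevX !mxE eqxx.
Qed.

End ExtendFamily.

Lemma dmap_flow0 X P x w : is_pact X P -> X x -> tangent_space X x w ->
  dmap (flow P 0) x w = w.
Proof.
move=> PX Xx tw; apply/rowP => j; rewrite mxE; apply/eqP.
rewrite -subr_eq0 -(dpevX x w j) -raddfB; apply/eqP/tw => y Xy.
have [_ P0 _] := PX y Xy.
have := congr1 (fun z : 'rV_n => z 0 j) (pmap_flow P 0 y).
by rewrite P0 mxE => E; rewrite pevalB E pevalX subrr.
Qed.

(** The flows of the [Ps] are applied to [y] one after another, each with its own time. In the last
    claim [rho] collects the conditions that the matching [hs] is nonzero at the point where each
    flow starts. *)
Lemma family_exists X y m (Ps : 'I_m -> 'I_n -> {poly {mpoly K[n]}}) :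
  X y -> (forall i, is_pact X (Ps i)) -> exists Phi : 'I_n -> {mpoly K[m]},
  [/\ forall t, exists g g', polyaut X g g' /\ pmap g y = pmap Phi t,
      forall i, dmap Phi 0 (delta_mx 0 i) = velocity (Ps i) y &
      forall (S : set 'rV[K]_n) (hs : 'I_m -> {mpoly K[n]}), S y ->
        (forall i, peval (hs i) y != 0) ->
        (forall i x t, S x -> peval (hs i) x != 0 -> S (pact (Ps i) t x)) ->
        exists2 rho, peval rho 0 != 0 & forall t, peval rho t != 0 -> S (pmap Phi t)].
Proof.
move=> Xy PX.
suff [Phi [H0 H1 H2 H3]] : exists Phi : 'I_n -> {mpoly K[m]},
  [/\ forall t, exists g g', polyaut X g g' /\ pmap g y = pmap Phi t,
      pmap Phi 0 = y,
      forall i, dmap Phi 0 (delta_mx 0 i) = velocity (Ps i) y &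
      forall (S : set 'rV[K]_n) (hs : 'I_m -> {mpoly K[n]}), S y ->
        (forall i, peval (hs i) y != 0) ->
        (forall i x t, S x -> peval (hs i) x != 0 -> S (pact (Ps i) t x)) ->
        exists2 rho, peval rho 0 != 0 & forall t, peval rho t != 0 -> S (pmap Phi t)].
  by exists Phi.
elim: m Ps PX => [|m IH] Ps PX.
  have E t : pmap (fun j => (y 0 j)%:MP_[0]) t = y.
    by apply/rowP => j; rewrite mxE pevalC.
  exists (fun j => (y 0 j)%:MP); split=> [t||[]//|S hs Sy _ _]; rewrite ?E //.
    exists (fun i => 'X_i), (fun i => 'X_i); split; first exact: polyaut_id.
    by apply/rowP => j; rewrite mxE pevalX.
  by exists 1; [rewrite peval1 oner_neq0|move=> t _; rewrite E].
have [Phi [H1 H2 H3 H4]] := IH (fun i => Ps (lift ord0 i)) (fun i => PX _).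
have tail0 : row_tail (0 : 'rV[K]_m.+1) = 0 by apply/rowP => i; rewrite !mxE.
have [_ P0 _] := PX ord0 y Xy.
have ext0 : pmap (extend_family Phi (Ps ord0)) 0 = y.
  by rewrite pmap_extend tail0 H2 mxE.
exists (extend_family Phi (Ps ord0)); split.
- move=> t; have [g [g' [gP gE]]] := H1 (row_tail t).
  have fP := flow_polyaut (t 0 ord0) (PX ord0).
  exists (fun j => mcomp g (flow (Ps ord0) (t 0 ord0) j)),
         (fun j => mcomp (flow (Ps ord0) (- t 0 ord0)) (g' j)).
  split; first exact: polyaut_comp fP gP.
  by rewrite pmap_mcomp gE pmap_flow pmap_extend.
- exact: ext0.
- move=> i; case: (unliftP ord0 i) => [j|] ->.
    rewrite dmap_extend_old tail0 H3 H2 mxE (dmap_flow0 (PX ord0) Xy) //.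
    exact: velocity_tangent_variety.
  by rewrite (dmap_extend_new (PX ord0)) ?ext0 // tail0 H2.
move=> S hs Sy hsy HS.
have [rho rho0 rhoP] := H4 S (fun i => hs (lift ord0 i)) Sy (fun i => hsy _)
  (fun i => HS _).
exists (mshift (rho * mcomp Phi (hs ord0))).
  by rewrite peval_mshift tail0 pevalM peval_mcomp H2 mulf_neq0.
move=> t; rewrite peval_mshift pevalM peval_mcomp mulf_eq0 negb_or => /andP[r0 h0].
by rewrite pmap_extend; apply: HS => //; apply: rhoP.
Qed.

Lemma rank_jacmx s (Phi : 'I_n -> {mpoly K[s]}) t (V : 'M[K]_(s, n)) :
  (forall i, dmap Phi t (delta_mx 0 i) = row i V) ->
  \rank (map_mx (evalp t) (jacmx Phi)) = \rank V.
Proof.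
move=> H; rewrite -mxrank_tr; congr (\rank _); apply/row_matrixP => i.
by rewrite -H dmap_mx rowE.
Qed.

(** By dominance, evaluation at [x] kills the kernel of the comorphism of [Phi] into the fraction
    field. Where [q] is nonzero it extends to the parameters, and their values form a preimage of
    [x]. *)
Lemma chevalley_dominant_image X s (Phi : 'I_n -> {mpoly K[s]}) rho :
  (forall t, X (pmap Phi t)) -> (forall p, mcomp Phi p = 0 -> vanish X p) -> rho != 0 ->
  exists2 q, ~ vanish X q & forall x, X x -> peval q x != 0 ->
    exists2 t, pmap Phi t = x & peval rho t != 0.
Proof.
move=> PhiX dom rho0.
pose F : {rmorphism {mpoly K[s]} -> _} := @FracField.tofrac {mpoly K[s]}.
pose psi : {rmorphism {mpoly K[n]} -> _} := F \o mcomp Phi.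
have [B [iota [Psi [b [PsiE bE ptE _]]]]] := extension_tower K psi (fun i => F 'X_i).
pose ev (p : {mpoly K[s]}) := mmap (iota \o @mpolyC n K) b p.
have PsiEv p : Psi (ev p) = F p.
  rewrite rmorph_mmap [RHS]rmorph_mpolyE.
  apply: eq_mmap => [c|i] /=; rewrite ?PsiE ?bE //=.
  by rewrite mcompC.
have [|q q0 H] := ptE (ev rho); first by rewrite PsiEv tofrac_eq0.
exists q.
  move=> qX; move/negP: q0; apply; rewrite /= tofrac_eq0; apply/negPn/negP.
  move=> /mpoly_nonroot[a]; have -> : (mcomp Phi q).@[a] = peval (mcomp Phi q) (\row_i a i).
    by apply: meval_eq => i; rewrite mxE.
  by rewrite peval_mcomp qX ?eqxx.
move=> x Xx qx; have [||chi [chiE ker chir]] := H (evalp x).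
- move=> p /eqP; rewrite /= tofrac_eq0 => /eqP /dom; exact.
- exact: qx.
pose t : 'rV[K]_s := \row_i chi (b i).
have chiEv p : chi (ev p) = peval p t.
  rewrite rmorph_mmap; apply: eq_mmap => [c|i] /=; last by rewrite mxE.
  by rewrite chiE; exact: pevalC.
exists t; last by rewrite -chiEv.
apply/rowP => j; rewrite mxE -chiEv -[RHS](pevalX j) -evalpE -chiE.
(* [iota 'X_j] and [ev (Phi j)] agree under [Psi], hence also under [chi]. *)
apply/eqP; rewrite -subr_eq0 -rmorphB ker // rmorphB /= PsiEv PsiE /= mcompX.
exact: subrr.
Qed.

End Families.

(** * From flexibility to cylinders *)

Section FlexibleToCovering.
Variables (K : closedFieldType) (charK : [pchar K] =i pred0) (n : nat).
Variables (X : set 'rV[K]_n) (hX : affine_variety X) (d : nat) (hd : krull_dim X d).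

Lemma not_vanish_prod m (F : 'I_m -> {mpoly K[n]}) :
  (forall i, ~ vanish X (F i)) -> ~ vanish X (\prod_i F i).
Proof.
have [_ X1 pr] := affine_variety_prime hX.
move=> FX; apply: (big_ind (fun p => ~ vanish X p)) => // p q pX qX.
by move=> /pr[].
Qed.

Definition velocities m (Ps : 'I_m -> 'I_n -> {poly {mpoly K[n]}}) y : 'M[K]_(m, n) :=
  \matrix_i velocity (Ps i) y.

(** Vectors tangent to orbits are multiples of velocities, by [orbit_tangent], so velocities span
    the tangent space and finitely many of them suffice. *)
Lemma flexible_velocities y : flexible X -> smooth_point X y ->
  exists m (Ps : 'I_m -> 'I_n -> {poly {mpoly K[n]}}),
  [/\ forall i, is_pact X (Ps i), forall i, exists t x, X x /\ pact (Ps i) t x <> x &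
      (d <= \rank (velocities Ps y))%N].
Proof.
move=> flex sy; have Xy : X y by case: sy.
have [M Mfree TM] := smooth_tangent hd sy.
pose good P := is_pact X P /\ exists t x, X x /\ pact P t x <> x.
have [m [V [VT TV]]] := finite_span [set w | exists P, good P /\ w = velocity P y].
have [Ps PsP] := choice VT; exists m, Ps.
split=> [i|i|]; [by have [[]] := PsP i|by have [[]] := PsP i|].
have -> : velocities Ps y = V.
  by apply/row_matrixP => i; rewrite rowK; have [_ ->] := PsP i.
rewrite -(eqP Mfree) mxrankS //; apply/row_subP => i.
have : tangent_space X y (row i M) by apply/TM/row_sub.
rewrite (flex y sy) => /linear_spanP[k [R [RT iR]]].
apply: submx_trans iR _; apply/row_subP => j.
have [a [aX aeff atan]] := RT j.
have [P [PX PE]] := Ga_action_pact hX aX.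
have orbE : Defs.orbit a y = Defs.orbit (pact P) y.
  by apply/seteqP; split=> z [t _ <-]; exists t => //; rewrite PE.
rewrite orbE in atan; have [c ->] := orbit_tangent charK PX Xy atan.
apply: scalemx_sub; apply: TV; exists P; split=> //; split=> //.
(* An effective action moves some point already at time [1]. *)
apply: contrapT => triv; have /eqP : (1 : K) = 0; last by rewrite oner_eq0.
apply: aeff => x Xx; rewrite -PE //.
by apply: contrapT => ne; apply: triv; exists 1, x.
Qed.

Lemma dominant_family y m (Ps : 'I_m -> 'I_n -> {poly {mpoly K[n]}})
    (Phi : 'I_n -> {mpoly K[m]}) :
  smooth_point X y -> (forall t, X (pmap Phi t)) ->
  (forall i, dmap Phi 0 (delta_mx 0 i) = velocity (Ps i) y) ->
  (d <= \rank (velocities Ps y))%N ->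
  forall p, mcomp Phi p = 0 -> vanish X p.
Proof.
move=> sy PhiX dPhi rk; have [M Mfree TM] := smooth_tangent hd sy.
apply: (dominant_of_rank charK hX sy.1 TM PhiX (t := 0)).
by rewrite (@rank_jacmx _ _ _ Phi 0 (velocities Ps y)) // => i; rewrite rowK.
Qed.

Definition sliced_at y m (Ps : 'I_m -> 'I_n -> {poly {mpoly K[n]}})
    (fs hs : 'I_m -> {mpoly K[n]}) :=
  [/\ forall i, is_pact X (Ps i), forall i, is_slice X (Ps i) (fs i) (hs i),
      forall i, peval (hs i) y != 0,
      forall i x, X x -> peval (hs i) x != 0 -> smooth_point X x &
      (d <= \rank (velocities Ps y))%N].

(* Slices exist near a general point only; an automorphism moving [y] to such a
   point carries them back to [y]. *)
Lemma sliced_at_smooth x0 : flexible X -> smooth_point X x0 -> exists m,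
  forall y, smooth_point X y -> exists (Ps : 'I_m -> _) fs hs, sliced_at y Ps fs hs.
Proof.
move=> flex s0; have [m [Ps [PX Pnt rk]]] := flexible_velocities flex s0.
have sl i := smooth_slice_exists charK hX hd s0 (PX i) (Pnt i).
have [fs /choice[hs slP]] := choice sl.
pose W : 'M[{mpoly K[n]}]_(m, n) := \matrix_(i, j) (Ps i j)`_1.
have WE x : velocities Ps x = map_mx (evalp x) W.
  by apply/matrixP => i j; rewrite !mxE.
have [a [b ab]] := nonzero_minor (velocities Ps x0).
(* Where [q] is nonzero, all the slices are defined and the velocities have at least the rank they
   have at [x0]. *)
pose q := (\prod_i hs i) * \det (mxsub a b W).
have qX : ~ vanish X q.
  have [_ _ pr] := affine_variety_prime hX.
  move=> /pr[]; first by apply: not_vanish_prod => i; have [] := slP i.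
  move=> /(_ x0 s0.1); rewrite -evalpE -det_map_mx map_mxsub -WE; apply/eqP.
  exact: ab.
exists m => y sy; have Xy := sy.1.
have [k [Qs [QX Qnt rkQ]]] := flexible_velocities flex sy.
have [Phi [Phiaut dPhi _]] := family_exists Xy QX.
have PhiX t : X (pmap Phi t).
  by have [g [g' [gP <-]]] := Phiaut t; have [] := gP y Xy.
have dom := dominant_family sy PhiX dPhi rkQ.
have /mpoly_nonroot[t0 qt0] : mcomp Phi q != 0 by apply/eqP => /dom.
have [g [g' [gP gE]]] := Phiaut (\row_i t0 i).
have Xgy : X (pmap g y) by rewrite gE.
have : peval q (pmap g y) != 0.
  rewrite gE -peval_mcomp; suff -> : peval (mcomp Phi q) (\row_i t0 i) = (mcomp Phi q).@[t0] by [].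
  by apply: meval_eq => i; rewrite mxE.
rewrite pevalM peval_prod mulf_eq0 negb_or => /andP[/prodf_neq0 hsg detg].
exists (fun i => conj_pact g g' (Ps i)), (fun i => mcomp g (fs i)), (fun i => mcomp g (hs i)).
split=> [i|i|i|i x Xx|].
- exact: conj_is_pact.
- by apply: conj_slice => //; have [] := slP i.
- by rewrite peval_mcomp hsg.
- rewrite peval_mcomp => hx; apply: (smooth_polyaut charK hX hd gP Xx).
  by have [_ _] := slP i; apply => //; have [] := gP x Xx.
move: detg; rewrite -evalpE -det_map_mx map_mxsub -WE => /minor_rank rkg.
apply: leq_trans rk _; apply: leq_trans rkg _.
have -> : velocities Ps (pmap g y) =
    velocities (fun i => conj_pact g g' (Ps i)) y *m (map_mx (evalp y) (jacmx g))^T.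
  apply/row_matrixP => i; rewrite row_mul !rowK -dmap_mx.
  by rewrite (conj_velocity gP (PX i) Xy).
exact: mxrankM_maxl.
Qed.

(** A pointwise form of invariance under all principal cylinders; the two points play symmetric
    roles, so it passes to complements. *)
Definition fiberwise (S : set 'rV[K]_n) := forall C : cylinder (smooth_locus X),
  principal X C -> forall x x', (C : set 'rV[K]_n) x -> (C : set 'rV[K]_n) x' ->
  cyl_proj C x = cyl_proj C x' -> S x -> S x'.

(** Where [hs i] is nonzero, the flow of [Ps i] runs inside a fibre of a principal cylinder and
    stays in [S]. These flows composed from [y] form a dominant family, whose image contains a dense
    open set. *)
Lemma fiberwise_dense S y m (Ps : 'I_m -> 'I_n -> {poly {mpoly K[n]}}) fs hs :
  sliced_at y Ps fs hs -> smooth_point X y -> fiberwise S -> S y ->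
  exists2 q, ~ vanish X q & forall x, X x -> peval q x != 0 -> S x.
Proof.
move=> [PX sl hy hs_smooth rk] sy Sfib Sy; have Xy := sy.1.
have [Phi [Phiaut dPhi PhiS]] := family_exists Xy PX.
have PhiX t : X (pmap Phi t).
  by have [g [g' [gP <-]]] := Phiaut t; have [] := gP y Xy.
have dom := dominant_family sy PhiX dPhi rk.
have [|rho rho0 rhoP] := PhiS (X `&` S) hs (conj Xy Sy) hy.
  move=> i x t [Xx Sx] hx; have [XP _ _] := PX i x Xx.
  split; first exact: XP.
  have hiX : ~ vanish X (hs i) by apply/not_vanish; exists y.
  have [C [CE Cpr Cflow]] := slice_cylinder hX (PX i) (sl i) hiX (hs_smooth i).
  apply: (Sfib C Cpr x) => //; rewrite ?CE /=; first by [].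
    by split; [exact: XP|rewrite (slice_invariant _ (PX i) (sl i))].
  by rewrite Cflow.
have [|q qX qP] := chevalley_dominant_image PhiX dom (rho := rho).
  by apply: contraNneq rho0 => ->; rewrite peval0.
by exists q => // x Xx qx; have [t <- rt] := qP x Xx qx; have [] := rhoP t rt.
Qed.

Lemma flexible_covering : (1 <= d)%N -> flexible X ->
  exists (I : Type) (C : I -> cylinder (smooth_locus X)),
    transversal_covering C /\ forall i, principal X (C i).
Proof.
move=> d1 flex; case: (pselect (exists x0, smooth_point X x0)) => [[x0 s0]|no]; last first.
  (* Without smooth points, the empty family is a covering. *)
  exists False, (fun i : False => match i with end); split=> //.
  have E : \bigcup_(i : False) (match i with end : cylinder (smooth_locus X)) = (set0 : set 'rV[K]_n).
    by rewrite -subset0 => x [].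
  split; last by rewrite E; apply/seteqP; split=> x // sx; case: no; exists x.
  by move=> S [x Sx] [SE _] _; have := SE x Sx; rewrite E.
exists {C : cylinder (smooth_locus X) | principal X C}, sval.
split; last by case.
have [m slP] := sliced_at_smooth flex s0.
have cover : \bigcup_(i : {C : cylinder (smooth_locus X) | principal X C})
    (sval i : set 'rV[K]_n) = smooth_locus X.
  apply/seteqP; split=> [x [[C Cpr] _ /=]|y sy].
    by have [D _ ->] := cyl_open C; case.
  have [Ps [fs [hs [PX sl hy hs_smooth rk]]]] := slP y sy.
  have m0 : (0 < m)%N.
    by apply: leq_trans d1 (leq_trans rk (rank_leq_row _)).
  pose i := Ordinal m0.
  have hiX : ~ vanish X (hs i) by apply/not_vanish; exists y => //; case: sy.
  have [C [CE Cpr Cflow]] := slice_cylinder hX (PX i) (sl i) hiX (hs_smooth i).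
  exists (exist _ C Cpr) => //=; rewrite CE; split=> //; by case: sy.
split=> // S [y Sy]; rewrite [X in _ `<` X]cover => -[Ssm /existsNP[y' /not_implyP[sy' nSy']]] Sinv.
have Sfib : fiberwise S.
  move=> C Cpr x x' Cx Cx' xx' Sx.
  have := Sinv (exist _ C Cpr); rewrite /Defs.invariant /= => E.
  suff : (S `&` C) x' by case.
  by rewrite E; split=> //; exists x.
have S'fib : fiberwise (~` S).
  by move=> C Cpr x x' Cx Cx' xx' nSx Sx'; apply/nSx/(Sfib C Cpr x' x).
have [Ps [fs [hs sly]]] := slP y (Ssm y Sy).
have [Ps' [fs' [hs' sly']]] := slP y' sy'.
have [q qX qS] := fiberwise_dense sly (Ssm y Sy) Sfib Sy.
have [q' q'X q'S] := fiberwise_dense sly' sy' S'fib nSy'.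
have [_ _ pr] := affine_variety_prime hX.
(* Two dense open sets of an irreducible variety meet, here at a point both inside and outside
   [S]. *)
have /not_vanish[x Xx] : ~ vanish X (q * q') by move=> /pr[].
rewrite pevalM mulf_eq0 negb_or => /andP[qx q'x].
exact: q'S x Xx q'x (qS x Xx qx).
Qed.

End FlexibleToCovering.

(** * From cylinders to flexibility *)

Section CylinderFlow.
Variables (K : closedFieldType) (n : nat).
Variables (X : set 'rV[K]_n) (hX : affine_variety X).

Lemma principal_polynomial (C : cylinder (smooth_locus X)) : principal X C ->
  exists h, (C : set 'rV[K]_n) = [set x | X x /\ peval h x != 0].
Proof.
move=> [h0 h0reg CE].
have [|p [N pE]] := @regular_principal_open K n X 1 h0 hX.1.
  apply/regular_onP => x [Xx _]; have /regular_onP/(_ x Xx)[p [q [qx Hpq]]] := h0reg.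
  by exists p, q; split=> // y [Xy _]; apply: Hpq.
exists p; rewrite CE; apply/seteqP; split=> x [Xx hx]; split=> //.
  by move: hx; rewrite pE ?peval1 ?oner_neq0 // expr1n divr1.
by rewrite pE ?peval1 ?oner_neq0 // expr1n divr1.
Qed.

Variables (C : cylinder (smooth_locus X)) (h : {mpoly K[n]}).
Hypothesis CE : (C : set 'rV[K]_n) = [set x | X x /\ peval h x != 0].
Let phi := cyl_iso C.
Let U : set 'rV[K]_n := C.
Variable c : 'rV[K]_(cyl_rank C).

(* Translations along [c] have poles along [h = 0]; since [h] is constant on the
   fibres, rescaling time by a power of [h] turns them into a polynomial action. *)
Lemma cylinder_flow : exists P N, is_pact X P /\ forall x t, (C : set 'rV[K]_n) x ->
  (C : set 'rV[K]_n) (pact P t x) /\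
  phi (pact P t x) = phi x + row_mx ((t * peval h x ^+ N) *: c) 0.
Proof.
have [[phiW phireg] [psi [[psiC psireg] psiK phiK]]] := cyl_isoP C.
rewrite -/phi in phiW phireg psiK phiK.
pose tr t x := phi x + row_mx (t *: c) 0.
pose Q t x := psi (tr t x).
have trW t x : U x -> affine_times (cyl_rank C) (cyl_base (c:=C)) (tr t x).
  move=> Cx; rewrite /affine_times /= /tr raddfD /= row_mxKr addr0.
  exact: phiW.
have QC t x : U x -> U (Q t x) by move=> Cx; apply/psiC/trW.
have phiQ t x : U x -> phi (Q t x) = tr t x by move=> Cx; apply/phiK/trW.
have Q0 x : U x -> Q 0 x = x.
  by move=> Cx; rewrite /Q /tr scale0r row_mx0 addr0 psiK.
have QD s t x : U x -> Q s (Q t x) = Q (s + t) x.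
  move=> Cx; rewrite {1}/Q /tr phiQ // /tr -addrA add_row_mx addr0 -scalerDl.
  by rewrite [t + s]addrC.
pose h' : {mpoly K[1 + n]} := mcomp (fun j => 'X_(rshift 1 j)) h.
have h'E y : peval h' y = peval h (rsubmx y).
  by rewrite peval_mcomp; congr peval; apply/rowP => j; rewrite !mxE pevalX.
pose W := [set y : 'rV[K]_(1 + n) | affine_times 1 X y /\ peval h' y != 0].
have WC y : W y -> U (rsubmx y) by rewrite /U CE => -[Xy]; rewrite h'E.
have rsub_reg k : regular_on W (fun y => rsubmx y 0 k).
  by apply: (regular_ext (@regular_coord _ _ W (rshift 1 k))) => y _; rewrite mxE.
have lsub_reg : regular_on W (fun y => lsubmx y 0 0).
  by apply: (regular_ext (@regular_coord _ _ W (lshift n 0))) => y _; rewrite mxE.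
have Qreg j : regular_on W (fun y => Q (lsubmx y 0 0) (rsubmx y) 0 j).
  apply: (@regular_comp _ _ _ W _ (fun y => tr (lsubmx y 0 0) (rsubmx y)) _ _ _ (psireg j)).
    by move=> y Wy; apply/trW/WC.
  move=> k.
  have H1 : regular_on W (fun y => phi (rsubmx y) 0 k).
    exact: (@regular_comp _ _ _ W _ _ _ WC rsub_reg (phireg k)).
  have H2 := regularM lsub_reg (@regular_cst _ _ W (row_mx c 0 0 k)).
  apply: (regular_ext (regularD H1 H2)) => y _; rewrite [RHS]mxE; congr (_ + _).
  by case: (split_ordP k) => i ->; rewrite ?row_mxEl ?row_mxEr !mxE // mulr0.
have Qpoly j : exists pN : {poly {mpoly K[n]}} * nat, forall t x, U x ->
    Q t x 0 j = (map_poly (evalp x) pN.1).[t] / peval h x ^+ pN.2.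
  have [p [N pE]] := regular_principal_open (affine_times_closed 1 hX.1) (Qreg j).
  have [q qE] := time_poly p; exists (q, N) => t x; rewrite /U CE => -[Xx hx].
  have := pE (row_mx (const_mx t) x).
  rewrite h'E /= row_mxKl row_mxKr mxE qE; apply=> //.
  by rewrite /affine_times /= row_mxKr.
have [pN pNE] := choice Qpoly.
(* [N] strictly exceeds all pole orders, so a positive power of [h] remains in each term of positive
   degree in time and the action is trivial where [h] vanishes. *)
pose N := (\sum_j (pN j).2).+1.
have NE j : ((pN j).2 < N)%N by rewrite /N ltnS (bigD1 j) //= leq_addr.
have hC x : U x -> peval h x != 0 by rewrite /U CE => -[].
have XC x : U x -> X x by rewrite /U CE => -[].
(* Translates stay in [U], so along them [h] is a polynomial in time without zeros, hence
   constant. *)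
have hQ t x : U x -> peval h (Q t x) = peval h x.
  move=> Cx.
  pose w j : {poly K} := (peval h x ^+ (pN j).2)^-1 *: map_poly (evalp x) (pN j).1.
  pose H := mmap polyC w h.
  have HE s : H.[s] = peval h (Q s x).
    rewrite -[LHS]/(horner_eval s H) rmorph_mmap; apply: eq_mmap => [a|j] /=.
      by rewrite /horner_eval hornerC.
    by rewrite /horner_eval hornerZ pNE // mulrC.
  have : size H == 1%N.
    apply/negPn/negP => /closed_rootP[s]; rewrite /root HE; apply/negP.
    exact/hC/QC.
  move=> /size_poly1P[a _ Ha].
  by rewrite -HE Ha hornerC -[in RHS](Q0 x Cx) -HE Ha hornerC.
(* The coefficients of [Q] in the rescaled time, with poles cleared; the constant one is ['X_j]
   because [Q] at time zero is the identity. *)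
pose P j : {poly {mpoly K[n]}} := \poly_(k < (size (pN j).1).+1)
  (if k == 0%N then 'X_j else (pN j).1`_k * h ^+ (N * k - (pN j).2)).
have PE t x j : (map_poly (evalp x) (P j)).[t] = x 0 j +
    \sum_(k < size (pN j).1) peval (pN j).1`_k.+1 x *
      peval h x ^+ (N * k.+1 - (pN j).2) * t ^+ k.+1.
  rewrite (@horner_coef_wide _ (size (pN j).1).+1); last first.
    by rewrite (leq_trans (size_poly _ _)) // size_poly.
  rewrite big_ord_recl /= coef_map coef_poly /= evalpE pevalX mulr1; congr (_ + _).
  apply: eq_bigr => k _; rewrite coef_map coef_poly /= /bump /= add1n.
  by rewrite ltnS ltn_ord evalpE pevalM pevalXn.
have PC t x : U x -> pact P t x = Q (t * peval h x ^+ N) x.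
  move=> Cx; apply/rowP => j; rewrite mxE PE pNE //; set e := (pN j).2.
  have hx := hC x Cx.
  have := pNE j 0 x Cx; rewrite Q0 // horner_coef0 => ->; rewrite -/e.
  rewrite [in RHS](@horner_coef_wide _ (size (pN j).1).+1); last first.
    by rewrite (leq_trans (size_poly _ _)).
  rewrite big_ord_recl expr0 mulr1 mulrDl; congr (_ + _).
  rewrite mulr_suml; apply: eq_bigr => k _; rewrite coef_map /= /bump /= add1n.
  have le_e : (e <= N * k.+1)%N by rewrite (leq_trans (ltnW (NE j))) // leq_pmulr.
  rewrite expfB_cond ?(negPf hx) ?add0n // exprMn -exprM evalpE.
  by ring.
have P_out t x : X x -> ~ U x -> pact P t x = x.
  rewrite /U CE => Xx /not_andP[//|/negP/negPn/eqP hx].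
  apply/rowP => j; rewrite mxE PE big1 ?addr0 // => k _.
  rewrite hx expr0n subn_eq0 leqNgt (leq_trans (NE j)) ?leq_pmulr //.
  by rewrite mulr0 mul0r.
have PCC t x : U x -> U (pact P t x) by move=> Cx; rewrite PC //; apply: QC.
exists P, N; split=> [x Xx|x t Cx]; last by split; [exact: PCC|rewrite PC // phiQ].
have [Cx|nCx] := pselect (U x); last by split=> *; rewrite !P_out.
split=> [t||s t]; first exact/XC/PCC.
- by rewrite PC // mul0r Q0.
by rewrite (PC t x Cx) (PC s _ (QC _ _ Cx)) (hQ _ _ Cx) (QD _ _ _ Cx) -mulrDl (PC _ _ Cx).
Qed.

End CylinderFlow.

(** Two points of a fibre differ by a translation, and the time [t] undoes the rescaling by a power
    of [h]. A translation by a nonzero vector moves [z'] at every nonzero time, whence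
    effectiveness. *)
Lemma fiber_flow (K : closedFieldType) n (X : set 'rV[K]_n)
    (C : cylinder (smooth_locus X)) z z' :
  affine_variety X -> principal X C -> (C : set 'rV[K]_n) z -> (C : set 'rV[K]_n) z' ->
  cyl_proj C z = cyl_proj C z' -> z <> z' ->
  exists P t, [/\ is_pact X P, effective X (pact P) & z = pact P t z'].
Proof.
move=> hX Cpr Cz Cz' zz' ne.
have [h CE] := principal_polynomial hX Cpr.
pose c := lsubmx (cyl_iso C z) - lsubmx (cyl_iso C z').
have [P [N [PX PC]]] := cylinder_flow hX CE c.
have isoz : cyl_iso C z = cyl_iso C z' + row_mx c 0.
  rewrite -[LHS]hsubmxK -[X in _ = X + _]hsubmxK add_row_mx addr0 /c addrC subrK.
  by congr row_mx.
have [_ [psi [_ psiK _]]] := cyl_isoP C.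
have c0 : c != 0.
  apply/eqP => c0; apply: ne; rewrite -(psiK z Cz) -(psiK z' Cz') isoz c0.
  by rewrite row_mx0 addr0.
have hz' : peval h z' != 0 by move: Cz'; rewrite CE => -[].
exists P, (peval h z' ^+ N)^-1; split=> //.
  move=> t Pt; have [_ E] := PC z' t Cz'; move: E; rewrite Pt; last first.
    by move: Cz'; rewrite CE => -[].
  move/eqP; rewrite -subr_eq0 opprD addrA subrr add0r oppr_eq0 => /eqP E.
  have : t * peval h z' ^+ N == 0.
    have /eqP := congr1 lsubmx E; rewrite row_mxKl linear0 scaler_eq0 (negPf c0) orbF.
    by [].
  by rewrite mulf_eq0 expf_eq0 (negPf hz') andbF orbF => /eqP.
have [CPz E] := PC z' (peval h z' ^+ N)^-1 Cz'.
rewrite -(psiK z Cz) -(psiK _ CPz) E isoz mulVf ?scale1r //.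
exact: expf_neq0.
Qed.

(** * Closures of images of polynomial maps *)

Section ParametrizedSubvarieties.
Variables (K : closedFieldType) (n s : nat) (Phi : 'I_n -> {mpoly K[s]}).

Lemma mcomp_eq0P p : mcomp Phi p = 0 <-> forall t, peval p (pmap Phi t) = 0.
Proof.
split=> [p0 t|H]; first by rewrite -peval_mcomp p0 peval0.
apply/eqP/negPn/negP => /mpoly_nonroot[a]; apply/negP/negPn/eqP.
rewrite -[RHS](H (\row_i a i)) -peval_mcomp.
by apply: meval_eq => i; rewrite mxE.
Qed.

Definition image_closure : set 'rV[K]_n := zero_locus [set p | mcomp Phi p = 0].

Lemma vanish_image_closure p : vanish image_closure p <-> mcomp Phi p = 0.
Proof.
split=> [pV|p0 x]; last by apply.
by apply/mcomp_eq0P => t; apply: pV => q /= q0; rewrite -peval_mcomp q0 peval0.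
Qed.

Lemma image_closure_pmap t : image_closure (pmap Phi t).
Proof. by move=> q /= q0; rewrite -peval_mcomp q0 peval0. Qed.

Lemma image_closure_variety : affine_variety image_closure.
Proof.
apply: prime_affine_variety; first exact: zero_locus_closed.
  by exists (pmap Phi 0); apply: image_closure_pmap.
move=> p q /vanish_image_closure /eqP; rewrite rmorphM mulf_eq0.
by move=> /orP[] /eqP ?; [left|right]; apply/vanish_image_closure.
Qed.

End ParametrizedSubvarieties.

Section CoveringToFlexible.
Variables (K : closedFieldType) (charK : [pchar K] =i pred0) (n : nat).
Variables (X : set 'rV[K]_n) (hX : affine_variety X) (d : nat) (hd : krull_dim X d).
Variable x0 : 'rV[K]_n.
Hypothesis Xx0 : X x0.

(** The condition on partial derivatives records that they come, through the differential of [g],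
    from velocities at [x0]; this brings a rank found at some [t] back to [x0]. *)
Definition orbit_family s (Phi : 'I_n -> {mpoly K[s]}) :=
  pmap Phi 0 = x0 /\ forall t, exists g g',
  [/\ polyaut X g g', pmap g x0 = pmap Phi t &
      forall i, exists P, [/\ is_pact X P, effective X (pact P) &
        dmap g x0 (velocity P x0) = dmap Phi t (delta_mx 0 i)]].

Lemma orbit_family_mem s (Phi : 'I_n -> {mpoly K[s]}) t :
  orbit_family Phi -> X (pmap Phi t).
Proof. by move=> [_ /(_ t)[g [g' [gP <- _]]]]; have [] := gP x0 Xx0. Qed.

Lemma constant_orbit_family : orbit_family (fun j => (x0 0 j)%:MP_[0]).
Proof.
have E t : pmap (fun j => (x0 0 j)%:MP_[0]) t = x0.
  by apply/rowP => j; rewrite mxE pevalC.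
split=> [|t]; rewrite ?E //; exists (fun i => 'X_i), (fun i => 'X_i).
split=> [||[]//]; first exact: polyaut_id.
by apply/rowP => j; rewrite mxE pevalX.
Qed.

Lemma extend_orbit_family s (Phi : 'I_n -> {mpoly K[s]}) P :
  orbit_family Phi -> is_pact X P -> effective X (pact P) ->
  orbit_family (extend_family Phi P).
Proof.
move=> Phifam PX Peff; have [Phi0 PhiP] := Phifam; split=> [|t].
  have -> : pmap (extend_family Phi P) 0 = pact P 0 (pmap Phi 0).
    rewrite pmap_extend mxE; congr (pact _ _ (pmap _ _)).
    by apply/rowP => i; rewrite !mxE.
  by rewrite Phi0; have [] := PX x0 Xx0.
have [g [g' [gP gE gT]]] := PhiP (row_tail t).
have fP := flow_polyaut (t 0 ord0) PX.
pose G j := mcomp g (flow P (t 0 ord0) j).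
pose G' j := mcomp (flow P (- t 0 ord0)) (g' j).
have GP : polyaut X G G' := polyaut_comp fP gP.
have GE : pmap G x0 = pmap (extend_family Phi P) t.
  by rewrite pmap_mcomp gE pmap_flow pmap_extend.
exists G, G'; split=> // i; case: (unliftP ord0 i) => [j|] ->.
  have [Q [QX Qeff QE]] := gT j; exists Q; split=> //.
  rewrite dmap_extend_old -gE -QE; apply/rowP => k.
  by rewrite [LHS]mxE /G dpev_mcomp [RHS]mxE.
exists (conj_pact G G' P); split.
- exact: conj_is_pact.
- exact: effective_conj.
rewrite (conj_velocity GP PX Xx0) GE (dmap_extend_new PX) //.
exact: orbit_family_mem.
Qed.

(** Setting the new time to zero recovers [Phi]. *)
Lemma extend_family_kernel s (Phi : 'I_n -> {mpoly K[s]}) P p :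
  orbit_family Phi -> is_pact X P ->
  mcomp (extend_family Phi P) p = 0 -> mcomp Phi p = 0.
Proof.
move=> Phifam PX /mcomp_eq0P H; apply/mcomp_eq0P => t.
have := H (row_cons 0 t); rewrite pmap_extend row_consK mxE unlift_none.
by have [_ -> _] := PX _ (orbit_family_mem t Phifam).
Qed.

(* Chains of subvarieties are bounded, so some orbit family has a closure that no
   further action enlarges. *)
Lemma maximal_orbit_family : exists s (Phi : 'I_n -> {mpoly K[s]}),
  orbit_family Phi /\ forall P, is_pact X P -> effective X (pact P) ->
  forall p, mcomp Phi p = 0 -> mcomp (extend_family Phi P) p = 0.
Proof.
have subX s (Phi : 'I_n -> {mpoly K[s]}) : orbit_family Phi -> image_closure Phi `<=` X.
  move=> Phifam x xV; rewrite -(zero_locus_vanish hX.1) => p pX; apply: xV.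
  by apply/mcomp_eq0P => t; apply/pX/orbit_family_mem.
(* The size of a closure is measured by the length of a chain of irreducible closed sets ending in
   it. *)
pose Q e := `[< exists s (Phi : 'I_n -> {mpoly K[s]}), orbit_family Phi /\
  exists F, irreducible_chain X e F /\ F e = image_closure Phi >].
have exQ : exists e, Q e.
  exists 0%N; apply/asboolP; exists 0%N, (fun j => (x0 0 j)%:MP).
  have fam := constant_orbit_family; split=> //.
  exists (fun=> image_closure (fun j => (x0 0 j)%:MP_[0])).
  by split=> //; split=> // i _; split; [exact: image_closure_variety|exact: subX].
have ubQ e : Q e -> (e <= d)%N.
  by move=> /asboolP[s [Phi [_ [F [Fc _]]]]]; apply: hd.2 Fc.
case: (ex_maxnP exQ ubQ) => e /asboolP[s [Phi [fam [F [[Fvar Fprop] Fe]]]]] maxe.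
exists s, Phi; split=> // P PX Peff p p0; apply: contrapT => pN.
have fam' := extend_orbit_family fam PX Peff.
suff /maxe : Q e.+1 by rewrite ltnn.
apply/asboolP; exists s.+1, (extend_family Phi P); split=> //.
(* A strictly larger closure would go on top of the longest chain. *)
exists (fun i => if (i <= e)%N then F i else image_closure (extend_family Phi P)).
rewrite ltnn; split=> //; split=> i ie.
  case: ifP => // [ie'|_]; first exact: Fvar.
  by split; [exact: image_closure_variety|exact: subX].
rewrite -ltnS ie; have [lt_ie|] := ltnP i e; first exact: Fprop.
move=> le_ei; have -> : i = e by apply/eqP; rewrite eqn_leq -ltnS ie le_ei.
rewrite Fe; split.
  by move=> x xV q /= q0; apply: xV; apply: extend_family_kernel q0.
move=> sub; apply: pN; apply/vanish_image_closure => x /sub; exact.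
Qed.

(** The closure of a maximal family is stable under the actions, so its trace on the smooth locus is
    invariant and by transversality is the whole smooth locus. It then contains a nonempty principal
    open subset, which is dense. *)
Lemma covering_dominant_family (I : Type) (C : I -> cylinder (smooth_locus X)) :
  smooth_point X x0 -> transversal_covering C -> (forall i, principal X (C i)) ->
  exists s (Phi : 'I_n -> {mpoly K[s]}), orbit_family Phi /\
    forall p, mcomp Phi p = 0 -> vanish X p.
Proof.
move=> s0 [trC covC] prC.
have [s [Phi [fam maxPhi]]] := maximal_orbit_family.
exists s, Phi; split=> // p p0.
pose S := image_closure Phi `&` smooth_locus X.
have S0 : S !=set0.
  by exists x0; split=> //; have [<- _] := fam; apply: image_closure_pmap.
have flowS P t z : is_pact X P -> effective X (pact P) -> image_closure Phi z ->
    image_closure Phi (pact P t z).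
  move=> PX Peff zV q /= q0; rewrite -pmap_flow -peval_mcomp; apply: zV => /=.
  apply/mcomp_eq0P => u; rewrite peval_mcomp pmap_flow.
  have /mcomp_eq0P/(_ (row_cons t u)) := maxPhi P PX Peff q q0.
  by rewrite pmap_extend row_consK mxE unlift_none.
have Sinv i : Defs.invariant (C i) S.
  apply/seteqP; split=> z; first by move=> [Sz Cz]; split=> //; exists z.
  move=> [Cz [z' [[z'V z's] Cz'] zz']]; split=> //.
  have sz : smooth_locus X z.
    by have [D _ E] := cyl_open (C i); move: (Cz); rewrite E => -[].
  split=> //; have [-> //|ne] := pselect (z = z').
  have [P [t [PX Peff ->]]] := fiber_flow hX (prC i) Cz Cz' (esym zz') ne.
  exact: flowS.
have SE : smooth_locus X `<=` S.
  apply: contrapT => nsub; apply: (trC S S0 _ Sinv); rewrite [X in _ `<` X]covC.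
  by split=> // z [].
have [i _ Cx0] : (\bigcup_i (C i : set 'rV[K]_n)) x0 by rewrite covC.
have [h hE] := principal_polynomial hX (prC i).
have hx0 : peval h x0 != 0 by move: Cx0; rewrite hE => -[].
apply: (@vanish_open _ _ X h p hX); first by apply/not_vanish; exists x0.
move=> x Xx hx; have Cx : (C i : set 'rV[K]_n) x by rewrite hE.
have sx : smooth_locus X x by rewrite -covC; exists i.
by have [/(_ p p0)] := SE x sx.
Qed.

(** By dominance, [d] independent functions on [X] stay independent after composition with [Phi].
    Pairing them with their dual derivations factors the identity matrix through the Jacobian of
    [Phi], and a nonzero minor of it is nonzero at some [t]. *)
Lemma dominant_family_rank s (Phi : 'I_n -> {mpoly K[s]}) :
  (forall p, mcomp Phi p = 0 -> vanish X p) ->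
  exists t, (d <= \rank (map_mx (evalp t) (jacmx Phi)))%N.
Proof.
move=> dom; have [u uX] := krull_indep hd.
pose F : {rmorphism {mpoly K[s]} -> {fraction {mpoly K[s]}}} :=
  @FracField.tofrac {mpoly K[s]}.
pose f : {rmorphism K -> {fraction {mpoly K[s]}}} := F \o @mpolyC s K.
pose w k := mcomp Phi (u k).
have FE r : mmap f (fun i => F 'X_i) r = F r by rewrite [RHS]rmorph_mpolyE.
have [|v [_ vw]] := @dual_derivations K _ f charK s (fun i => F 'X_i) d w.
  move=> G G0; apply: uX; apply: dom.
  suff -> : mcomp Phi (mcomp u G) = mcomp w G.
    apply/eqP; rewrite -tofrac_eq0; apply/eqP; rewrite -[RHS]G0.
    by rewrite /mcomp (rmorph_mmap _ _ F); apply: eq_mmap.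
  rewrite /mcomp rmorph_mmap; apply: eq_mmap => // c /=.
  by rewrite mmapC.
have rkF : (d <= \rank (map_mx F (jacmx Phi)))%N.
  have -> : d = \rank (1%:M : 'M[{fraction {mpoly K[s]}}]_d) by rewrite mxrank1.
  have -> : 1%:M = map_mx F (\matrix_(k, l) mcomp Phi (u k)^`M(l)) *m
     (map_mx F (jacmx Phi) *m (\matrix_(i, j) v i j)^T).
    rewrite mulmxA -map_mxM; apply/matrixP => k i; rewrite !mxE -(vw k i).
    apply: eq_bigr => j _; rewrite FE !mxE /w mderiv_mcomp; congr (F _ * _).
    by apply: eq_bigr => l _; rewrite !mxE.
  exact: leq_trans (mxrankM_maxr _ _) (mxrankM_maxl _ _).
have [a [b]] := nonzero_minor (map_mx F (jacmx Phi)).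
rewrite -map_mxsub det_map_mx tofrac_eq0 => /mpoly_nonroot[t tab].
exists (\row_i t i); apply: leq_trans rkF _; apply: (minor_rank (f := a) (g := b)).
rewrite -map_mxsub det_map_mx /= evalpE.
rewrite (_ : peval _ _ = (\det (mxsub a b (jacmx Phi))).@[t]) //.
by apply: meval_eq => i; rewrite mxE.
Qed.

(** At a [t] of rank at least [d], the partial derivatives are images under the differential of [g]
    of velocities at [x0], which therefore have rank at least [d] and span the tangent space. *)
Lemma covering_flexible_point (I : Type) (C : I -> cylinder (smooth_locus X)) :
  smooth_point X x0 -> transversal_covering C -> (forall i, principal X (C i)) ->
  flexible_point X x0.
Proof.
move=> s0 covC prC; have [M Mfree TM] := smooth_tangent hd s0.
have [s [Phi [[_ PhiP] dom]]] := covering_dominant_family s0 covC prC.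
have [t rk] := dominant_family_rank dom.
have [g [g' [gP _ gT]]] := PhiP t; have [Ps PsP] := choice gT.
pose V : 'M[K]_(s, n) := \matrix_i velocity (Ps i) x0.
have VM : (V <= M)%MS.
  apply/row_subP => i; rewrite rowK; apply/TM.
  by have [PX _ _] := PsP i; apply: velocity_tangent_variety.
have MV : (M <= V)%MS.
  have [_ <-] := mxrank_leqif_sup VM; rewrite eqn_leq mxrankS //= (eqP Mfree).
  apply: leq_trans rk _.
  rewrite (@rank_jacmx _ _ _ Phi t (V *m (map_mx (evalp x0) (jacmx g))^T)).
    exact: mxrankM_maxl.
  by move=> i; rewrite row_mul rowK -dmap_mx; have [_ _ ->] := PsP i.
apply/seteqP; split=> v.
  move=> /TM vM; apply/linear_spanP; exists s, V; split; last exact: submx_trans vM MV.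
  move=> i; rewrite rowK; have [PX Peff _] := PsP i; exists (pact (Ps i)).
  by split=> //; [exact: pact_Ga_action|exact: (velocity_tangent PX Xx0)].
(* Orbits lie in [X], so vectors tangent to them are tangent to [X]. *)
move=> /linear_spanP[m [R [RT vR]]]; apply/TM; apply: submx_trans vR _.
apply/row_subP => j; apply/TM; have [a [[[aX _] _ _] _ at_]] := RT j.
move=> p pX; apply: at_ => y [c _ <-]; apply: pX.
have := aX (row_mx (const_mx c) x0); rewrite row_mxKl row_mxKr mxE; apply.
by rewrite /affine_times /= row_mxKr.
Qed.

End CoveringToFlexible.

Theorem proposition3p4 (K : closedFieldType) (charK0 : [pchar K] =i pred0)
    (n : nat) (X : set 'rV[K]_n) (hX : affine_variety X)
    (d : nat) (hd : krull_dim X d) (d_ge1 : (1 <= d)%N) :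
  flexible X <->
  exists (I : Type) (C : I -> cylinder (smooth_locus X)),
    transversal_covering C /\ forall i, principal X (C i).
Proof.
split; first exact: (flexible_covering charK0 hX hd d_ge1).
move=> [I [C [covC prC]]] x sx.
exact: (covering_flexible_point charK0 hX hd sx.1 sx covC prC).
Qed.
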